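(* Let $g$ be an arithmetic function and let $f(n)=\sum_{d\mid n}g(d)$ for every $n\geqslant 1$. Suppose that $f(n),g(n)\ll_{\alpha}n^{\alpha}$ for some fixed $\alpha$ with $0<\alpha<1$. For $\operatorname{Re} z>1+\alpha$ let $L(z;f)=\sum_{n=1}^{+\infty}\frac{f(n)}{n^{z}}$. Then for every integer $k\geqslant 1$, $$L^{2}(2k;f)=\sum_{m=1}^{+\infty}\frac{g(m)}{m}\biggl(\,\sum_{n=1}^{+\infty}\frac{f(n)}{n^{4k-1}}\,a_{k}\Bigl(\frac{n}{m}\Bigr)-mL(4k;f)\biggr).$$
   Context: An arithmetic function is a complex-valued function on the positive integers. The notation $h(n)\ll_{\alpha}n^{\alpha}$ means that there is a constant $C$ (depending on $\alpha$) with $|h(n)|\leqslant Cn^{\alpha}$ for all $n\geqslant 1$. For integers $k\geqslant 1$ and $r\geqslant 0$ put $\varepsilon_{r}=\varepsilon_{r}(k)=\exp\bigl(\frac{2\pi i(r+1/2)}{2k}\bigr)$. For real $w>0$ define $a_{k}(w)=\frac{1}{k}\sum_{r=0}^{k-1}\pi\varepsilon_{r}\cot(\pi\varepsilon_{r}w)$. *)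

(* Defs.v *)
From Stdlib Require Import Reals Arith List.
From Coquelicot Require Import Coquelicot.

Open Scope R_scope.

(* Arithmetic functions are functions nat -> C of which only the values at
   n >= 1 are used; a series over n >= 1 is indexed by j with n = S j. *)

(* exp (x + iy) = e^x (cos y + i sin y) *)
Definition Cexp (z : C) : C :=
  (exp (Re z) * cos (Im z), exp (Re z) * sin (Im z)).

Definition Ccos (z : C) : C := ((Cexp (Ci * z) + Cexp (- (Ci * z))) / 2)%C.

Definition Csin (z : C) : C :=
  ((Cexp (Ci * z) - Cexp (- (Ci * z))) / (2 * Ci))%C.

Definition Ccot (z : C) : C := (Ccos z / Csin z)%C.

(* The complex power n ^ z = exp (z log n), meaningful for n >= 1 only. *)
Definition nat_cpow (n : nat) (z : C) : C := Cexp (z * RtoC (ln (INR n)))%C.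

(* The limit of the partial sums when the series converges, and an unspecified
   complex number otherwise. *)
Definition Csum (u : nat -> C) : C :=
  @iota C_CompleteNormedModule (fun l : C => is_series u l).

Definition Csum_from1 (u : nat -> C) : C := Csum (fun j => u (S j)).

Definition divisors (n : nat) : list nat :=
  filter (fun d => Nat.eqb (n mod d) 0) (seq 1 n).

Definition divisor_sum (g : nat -> C) (n : nat) : C :=
  fold_right Cplus (RtoC 0) (map g (divisors n)).

(* h(n) <<_alpha n^alpha *)
Definition dominated_by_power (h : nat -> C) (alpha : R) : Prop :=
  exists K : R, forall n : nat, (1 <= n)%nat ->
    Cmod (h n) <= K * Rpower (INR n) alpha.

Definition dirichlet_L (z : C) (f : nat -> C) : C :=
  Csum_from1 (fun n => f n / nat_cpow n z)%C.

Definition epsilon (k r : nat) : C :=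
  Cexp (2 * RtoC PI * Ci * (RtoC (INR r) + 1 / 2) / (2 * RtoC (INR k)))%C.

Definition a_k (k : nat) (w : R) : C :=
  (1 / RtoC (INR k)
   * sum_n_m (fun r =>
       RtoC PI * epsilon k r * Ccot (RtoC PI * epsilon k r * RtoC w))
       0 (k - 1))%C.

Definition inner_term (f : nat -> C) (k m n : nat) : C :=
  (f n / RtoC (INR n) ^ (4 * k - 1) * a_k k (INR n / INR m))%C.

(* Main.v *)
Require Import Defs.
From Stdlib Require Import Reals Lra Lia List.
From Coquelicot Require Import Coquelicot.

(** Write L for L(2k; f). The cotangent has the partial fraction expansion
      pi cot(pi z) = 1/z + sum_(l >= 1) 2z / (z^2 - l^2),
    and the numbers epsilon_r^2 are the k-th roots of -1, so that averaging the
    expansions at z = epsilon_r w gives, for w > 0 ([a_k_series]),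
      a_k(w) = 1/w + 2 sum_(l >= 1) w^(2k-1) / (l^2k + w^2k).
    At w = n/m the term 1/w contributes m f(n) / n^4k to the inner series, which sums
    to m L(4k; f) and is subtracted off. With K(a, b) = 1 / (a^2k + b^2k), the
    m-th outer term is therefore ([inner_term_split])
      2 g(m) sum_n f(n) n^(-2k) sum_l K(l m, n).
    Everything converges absolutely, because K(l m, n) <= (l m)^(-2k) and alpha < 1.
    Summing over m and l first, g(m) summed over the factorizations N = l m is f(N)
    ([divisor_switch]), and the outer series equals
      2 sum_n sum_N f(n) f(N) n^(-2k) K(N, n).
    Finally (n^(-2k) + N^(-2k)) K(N, n) = n^(-2k) N^(-2k): adding the double series to
    itself with n and N exchanged gives the product series, whose sum is L^2.

    Two analytic tools are needed. Dominated convergence for series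
    ([dominated_convergence]) yields the interchange of summations ([fubini]) and the
    expansion of the cotangent. The latter starts from the duplication formula
    2 cot 2x = cot x + cot (x + pi/2), whose iteration writes pi cot(pi z) as a
    finite average of pi cot(pi (z + n) / N) over residues n modulo N = 2^(p+1)
    ([pcot_finite_sum]); as N grows each summand tends to 1/(z + n), and grouping n
    with -1-n gives a majorant of order 1/n^2 ([pcot_pair_bound]). *)

(** * Elementary facts *)

(** Terms of [sum_n] over [C] live in the carrier of a structure, where [ring] and
    [field] find no instance; this restates the goal in [C] itself. *)
Ltac C_eq := match goal with |- ?a = ?b => change (@eq C a b) end.

Lemma INR_S_pos (n : nat) : 0 < INR (S n).
Proof. apply lt_0_INR. lia. Qed.

Lemma INR_S_ge_1 (n : nat) : 1 <= INR (S n).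
Proof. rewrite S_INR. pose proof (pos_INR n). lra. Qed.

Lemma RtoC_neq_0 (x : R) : x <> 0 -> RtoC x <> 0%C.
Proof. intros Hx H. apply Hx. now injection H. Qed.

Lemma Im_neq_0 (z : C) : Im z <> 0 -> z <> 0%C.
Proof. intros Hz ->. now apply Hz. Qed.

Lemma Im_plus_R (z : C) (x : R) : Im (z + RtoC x)%C = Im z.
Proof. destruct z. simpl. ring. Qed.

Lemma Im_minus_R (z : C) (x : R) : Im (z - RtoC x)%C = Im z.
Proof. destruct z. simpl. ring. Qed.

Lemma Im_div_R (z : C) (x : R) : x <> 0 -> Im (z / RtoC x)%C = Im z / x.
Proof. intros Hx. destruct z as [a b]. simpl. now field. Qed.

Lemma Im_div_R_neq_0 (z : C) (x : R) :
  x <> 0 -> Im z <> 0 -> Im (z / RtoC x)%C <> 0.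
Proof.
  intros Hx Hz. rewrite Im_div_R by exact Hx. unfold Rdiv.
  apply Rmult_integral_contrapositive_currified; [exact Hz|].
  now apply Rinv_neq_0_compat.
Qed.

Lemma C2_neq_0 : RtoC 2 <> 0%C.
Proof. intros H. injection H. lra. Qed.

Lemma Ci_neq_0 : Ci <> 0%C.
Proof. intros H. injection H. lra. Qed.

(** * Limits of complex sequences *)

Definition Clim (u : nat -> C) (l : C) : Prop :=
  filterlim u eventually (locally l).

Lemma Clim_eps (u : nat -> C) (l : C) :
  Clim u l <->
  forall eps : posreal, eventually (fun n => Cmod (u n - l)%C < eps).
Proof.
  exact (@filterlim_locally_ball_norm C_AbsRing nat C_NormedModule eventually _ u l).
Qed.

(** Reduces sums, products and inverses to the corresponding facts on real limits. *)
Lemma Clim_components (u : nat -> C) (l : C) :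
  Clim u l <->
  is_lim_seq (fun n => Re (u n)) (Re l) /\ is_lim_seq (fun n => Im (u n)) (Im l).
Proof.
  split.
  - intros H. rewrite Clim_eps in H. split; apply is_lim_seq_spec; intros eps.
    + destruct (H eps) as [N HN]. exists N. intros n Hn.
      apply Rle_lt_trans with (2 := HN n Hn).
      exact (re_le_Cmod (u n - l)%C).
    + destruct (H eps) as [N HN]. exists N. intros n Hn.
      apply Rle_lt_trans with (2 := HN n Hn).
      apply Rle_trans with (2 := Rmax_Cmod (u n - l)%C). apply Rmax_r.
  - intros [H1 H2].
    apply (filterlim_ext (fun n => (Re (u n), Im (u n)))).
    { intros n. now destruct (u n). }
    destruct l as [a b].
    intros P [e He].
    specialize (H1 _ (locally_ball a e)). specialize (H2 _ (locally_ball b e)).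
    unfold filtermap in *. generalize (filter_and _ _ H1 H2).
    apply filter_imp. intros n [Ha Hb]. apply He. now split.
Qed.

Lemma Clim_ext (u v : nat -> C) (l : C) :
  (forall n, u n = v n) -> Clim u l -> Clim v l.
Proof. exact (filterlim_ext u v). Qed.

Lemma Clim_ext_loc (u v : nat -> C) (l : C) :
  eventually (fun n => u n = v n) -> Clim u l -> Clim v l.
Proof. exact (filterlim_ext_loc u v). Qed.

Lemma Clim_const (l : C) : Clim (fun _ => l) l.
Proof. apply filterlim_const. Qed.

Lemma Clim_unique (u : nat -> C) (l l' : C) : Clim u l -> Clim u l' -> l = l'.
Proof.
  exact (filterlim_locally_unique (V := C_NormedModule) (F := eventually) u l l').
Qed.

Lemma Clim_plus (u v : nat -> C) (a b : C) :
  Clim u a -> Clim v b -> Clim (fun n => u n + v n)%C (a + b)%C.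
Proof.
  rewrite !Clim_components. intros [H1 H2] [H3 H4]. split.
  - exact (is_lim_seq_plus' _ _ _ _ H1 H3).
  - exact (is_lim_seq_plus' _ _ _ _ H2 H4).
Qed.

Lemma Clim_mult (u v : nat -> C) (a b : C) :
  Clim u a -> Clim v b -> Clim (fun n => u n * v n)%C (a * b)%C.
Proof.
  rewrite !Clim_components. intros [H1 H2] [H3 H4]. split; simpl.
  - apply is_lim_seq_minus'; now apply is_lim_seq_mult'.
  - apply is_lim_seq_plus'; now apply is_lim_seq_mult'.
Qed.

Lemma Clim_inv (u : nat -> C) (a : C) :
  a <> 0%C -> Clim u a -> Clim (fun n => / u n)%C (/ a)%C.
Proof.
  intros Ha. rewrite !Clim_components. intros [H1 H2].
  assert (Hd : Re a ^ 2 + Im a ^ 2 <> 0).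
  { rewrite <- Cmod2_alt. apply pow_nonzero, Rgt_not_eq. now apply Cmod_gt_0. }
  assert (H3 : is_lim_seq (fun n => Re (u n) ^ 2 + Im (u n) ^ 2)
                          (Re a ^ 2 + Im a ^ 2)).
  { simpl. repeat first [ apply is_lim_seq_plus' | apply is_lim_seq_mult'
                        | apply is_lim_seq_const | assumption ]. }
  split; simpl.
  - now apply is_lim_seq_div'.
  - apply is_lim_seq_div'; [ | assumption | assumption ].
    now apply (is_lim_seq_opp _ (Im a)).
Qed.

Lemma Clim_RtoC (u : nat -> R) (l : R) :
  is_lim_seq u l -> Clim (fun n => RtoC (u n)) (RtoC l).
Proof.
  intros H. apply Clim_components. split; [exact H | apply is_lim_seq_const].
Qed.

Lemma Clim_Cmod (u : nat -> C) (l : C) :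
  Clim u l -> is_lim_seq (fun n => Cmod (u n)) (Cmod l).
Proof.
  intros H.
  exact (filterlim_comp _ _ _ u (@norm C_AbsRing C_NormedModule) _ _ _ H (filterlim_norm l)).
Qed.

(** * Finite sums of complex numbers *)

Lemma sum_n_Cext (u v : nat -> C) n : (forall i, u i = v i) -> sum_n u n = sum_n v n.
Proof. exact (sum_n_ext u v n). Qed.

Lemma sum_n_CS (u : nat -> C) n : sum_n u (S n) = (sum_n u n + u (S n))%C.
Proof. exact (sum_Sn u n). Qed.

Lemma sum_n_RS (u : nat -> R) n : sum_n u (S n) = sum_n u n + u (S n).
Proof. exact (sum_Sn u n). Qed.

Lemma sum_n_Cminus (u v : nat -> C) n :
  sum_n (fun i => u i - v i)%C n = (sum_n u n - sum_n v n)%C.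
Proof.
  induction n as [|n IH]; [now rewrite !sum_O | rewrite !sum_n_CS, IH].
  C_eq. ring.
Qed.

Lemma sum_n_Cscal (c : C) (u : nat -> C) (n : nat) :
  sum_n (fun i => c * u i)%C n = (c * sum_n u n)%C.
Proof. exact (sum_n_scal_l c u n). Qed.

Lemma sum_n_Cconst (c : C) (n : nat) :
  sum_n (fun _ => c) n = (RtoC (INR (S n)) * c)%C.
Proof.
  induction n as [|n IH].
  - rewrite sum_O. simpl. C_eq. ring.
  - rewrite sum_n_CS, IH, (S_INR (S n)), RtoC_plus. C_eq. ring.
Qed.

Lemma sum_n_head (u : nat -> C) (n : nat) :
  sum_n u (S n) = (u 0%nat + sum_n (fun i => u (S i)) n)%C.
Proof.
  induction n as [|n IH].
  - now rewrite sum_n_CS, !sum_O.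
  - rewrite sum_n_CS, IH, sum_n_CS.
    C_eq. ring.
Qed.

Lemma sum_n_fold (u : nat -> C) (m : nat) :
  sum_n u (2 * m + 1) = sum_n (fun j => u j + u (2 * m + 1 - j)%nat)%C m.
Proof.
  revert u. induction m as [|m IH]; intros u.
  - simpl. now rewrite sum_n_CS, !sum_O.
  - replace (2 * S m + 1)%nat with (S (S (2 * m + 1))) by lia.
    rewrite sum_n_CS, sum_n_head, (IH (fun i => u (S i))).
    rewrite (sum_n_head (fun j => u j + u (S (S (2 * m + 1)) - j)%nat)%C).
    rewrite (sum_n_ext_loc (fun j => u (S j) + u (S (2 * m + 1 - j)))%C
               (fun i => u (S i) + u (S (S (2 * m + 1)) - S i)%nat)%C m).
    + C_eq.
      replace (S (S (2 * m + 1)) - 0)%nat with (S (S (2 * m + 1))) by lia. ring.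
    + intros i Hi. do 2 f_equal. lia.
Qed.

Lemma sum_n_last (u : nat -> C) (n : nat) :
  (forall j, (j < n)%nat -> u j = 0%C) -> sum_n u n = u n.
Proof.
  destruct n as [|n]; intros H; [now rewrite sum_O|].
  rewrite sum_n_CS. rewrite (sum_n_ext_loc u (fun _ => 0 * 0)%C n).
  - rewrite sum_n_Cscal. C_eq. ring.
  - intros j Hj. rewrite H by lia. C_eq. ring.
Qed.

Lemma sum_n_exchange (u : nat -> nat -> C) (m n : nat) :
  sum_n (fun i => sum_n (u i) n) m = sum_n (fun j => sum_n (fun i => u i j) m) n.
Proof. exact (sum_n_switch u m n). Qed.

Lemma Cmod_sum_n_le (u : nat -> C) (b : nat -> R) n :
  (forall i, Cmod (u i) <= b i) -> Cmod (sum_n u n) <= sum_n b n.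
Proof.
  intros H. induction n as [|n IH].
  - rewrite !sum_O. apply H.
  - rewrite sum_n_CS, sum_n_RS. apply Rle_trans with (1 := Cmod_triangle _ _).
    now apply Rplus_le_compat.
Qed.

Lemma Clim_sum_n (v : nat -> nat -> C) (w : nat -> C) J :
  (forall i, Clim (fun n => v n i) (w i)) ->
  Clim (fun n => sum_n (v n) J) (sum_n w J).
Proof.
  intros H. induction J as [|J IH].
  - rewrite sum_O. apply (Clim_ext (fun n => v n 0%nat)); [|apply H].
    intros n. now rewrite sum_O.
  - rewrite sum_n_CS. apply (Clim_ext (fun n => sum_n (v n) J + v n (S J))%C).
    + intros n. now rewrite sum_n_CS.
    + now apply Clim_plus.
Qed.

(** * Series *)

Lemma is_series_Clim (u : nat -> C) (l : C) :
  is_series u l <-> Clim (fun n => sum_n u n) l.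
Proof. reflexivity. Qed.

Lemma is_series_unique_C (u : nat -> C) (l l' : C) :
  is_series u l -> is_series u l' -> l = l'.
Proof. apply Clim_unique. Qed.

Lemma Csum_unique (u : nat -> C) (l : C) : is_series u l -> Csum u = l.
Proof.
  intros H. unfold Csum.
  exact (iota_filterlim_locally (V := C_CompleteNormedModule) _ l H).
Qed.

Lemma Csum_correct (u : nat -> C) : ex_series u -> is_series u (Csum u).
Proof. intros [l Hl]. now rewrite (Csum_unique _ _ Hl). Qed.

Lemma is_series_Cscal (c : C) (u : nat -> C) (l : C) :
  is_series u l -> is_series (fun n => c * u n)%C (c * l)%C.
Proof. exact (is_series_scal c u l). Qed.

Lemma is_series_Cplus (u v : nat -> C) (a b : C) :
  is_series u a -> is_series v b -> is_series (fun n => u n + v n)%C (a + b)%C.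
Proof. exact (is_series_plus u v a b). Qed.

Lemma is_series_Cminus (u v : nat -> C) (a b : C) :
  is_series u a -> is_series v b -> is_series (fun n => u n - v n)%C (a - b)%C.
Proof. exact (is_series_minus u v a b). Qed.

Lemma is_series_Cext (u v : nat -> C) (l l' : C) :
  (forall n, u n = v n) -> l = l' -> is_series u l -> is_series v l'.
Proof. intros H <-. now apply is_series_ext. Qed.

Lemma is_series_Rscal (c : R) (u : nat -> R) (l : R) :
  is_series u l -> is_series (fun n => c * u n) (c * l).
Proof. exact (is_series_scal_l c u l). Qed.

Lemma ex_series_Rscal (c : R) (u : nat -> R) :
  ex_series u -> ex_series (fun n => c * u n).
Proof. exact (ex_series_scal_l c u). Qed.

Lemma ex_series_Rle (u b : nat -> R) :
  (forall n, 0 <= u n <= b n) -> ex_series b -> ex_series u.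
Proof.
  intros H. apply (ex_series_le (V := R_CompleteNormedModule) u b).
  intros n. change (Rabs (u n) <= b n). rewrite Rabs_pos_eq; apply H.
Qed.

Lemma ex_series_Cle (u : nat -> C) (b : nat -> R) :
  (forall n, Cmod (u n) <= b n) -> ex_series b -> ex_series u.
Proof. exact (ex_series_le (V := C_CompleteNormedModule) u b). Qed.

Lemma is_series_RtoC (u : nat -> R) (l : R) :
  is_series u l -> is_series (fun n => RtoC (u n)) (RtoC l).
Proof.
  intros H. apply is_series_Clim. apply (Clim_ext (fun n => RtoC (sum_n u n))).
  - intros n. induction n as [|n IH]; [now rewrite !sum_O|].
    now rewrite sum_n_CS, sum_n_RS, RtoC_plus, IH.
  - apply Clim_RtoC. exact H.
Qed.

Lemma is_series_sum_n (u : nat -> nat -> C) (l : nat -> C) (n : nat) :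
  (forall r, (r <= n)%nat -> is_series (u r) (l r)) ->
  is_series (fun j => sum_n (fun r => u r j) n) (sum_n l n).
Proof.
  intros H. induction n as [|n IH].
  - apply (is_series_Cext (u 0%nat) _ (l 0%nat)).
    + intros j. now rewrite sum_O.
    + now rewrite sum_O.
    + apply H. lia.
  - apply (is_series_Cext (fun j => sum_n (fun r => u r j) n + u (S n) j)%C _
             (sum_n l n + l (S n))%C).
    + intros j. now rewrite sum_n_CS.
    + now rewrite sum_n_CS.
    + apply is_series_Cplus; [apply IH; intros r Hr; apply H; lia | apply H; lia].
Qed.

Lemma is_series_finite (u : nat -> C) (m : nat) :
  (forall j, (m < j)%nat -> u j = 0%C) -> is_series u (sum_n u m).
Proof.
  intros H. apply is_series_Clim. apply (Clim_ext_loc (fun _ => sum_n u m)); [|apply Clim_const].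
  exists m. intros n Hn. induction Hn as [|n Hn IH]; [reflexivity|].
  rewrite sum_n_CS, <- IH, (H (S n)) by lia.
  now rewrite Cplus_0_r.
Qed.

Lemma is_series_Ctail (u : nat -> C) (l : C) J :
  is_series u l -> is_series (fun k => u (S J + k)%nat) (l - sum_n u J)%C.
Proof.
  intros H. apply (is_series_incr_n u (S J)); [lia|].
  change (is_series u (l - sum_n u J + sum_n u J)%C).
  now replace (l - sum_n u J + sum_n u J)%C with l by ring.
Qed.

Lemma sum_n_le_series (b : nat -> R) (B : R) n :
  (forall i, 0 <= b i) -> is_series b B -> sum_n b n <= B.
Proof.
  intros Hb HB. apply (is_lim_seq_incr_compare (sum_n b)).
  - exact HB.
  - intros m. rewrite sum_n_RS. specialize (Hb (S m)). lra.
Qed.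

Lemma term_le_series (b : nat -> R) (B : R) n :
  (forall i, 0 <= b i) -> is_series b B -> b n <= B.
Proof.
  intros Hb HB. apply Rle_trans with (2 := sum_n_le_series b B n Hb HB).
  destruct n as [|n].
  - rewrite sum_O. apply Rle_refl.
  - rewrite sum_n_RS. pose proof (cond_pos_sum b n Hb).
    rewrite sum_n_Reals. lra.
Qed.

Lemma Cmod_series_le (u : nat -> C) (b : nat -> R) (l : C) (B : R) :
  (forall i, Cmod (u i) <= b i) -> is_series u l -> is_series b B -> Cmod l <= B.
Proof.
  intros H Hu Hb.
  apply (is_lim_seq_le (fun n => Cmod (sum_n u n)) (sum_n b) (Cmod l) B).
  - intros n. now apply Cmod_sum_n_le.
  - now apply Clim_Cmod.
  - exact Hb.
Qed.

Lemma series_tail_small (b : nat -> R) (i0 : nat) (eps : posreal) :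
  ex_series b ->
  exists J B, (i0 <= J)%nat /\ is_series (fun k => b (S J + k)%nat) B /\ B < eps.
Proof.
  intros [B HB]. change R in B.
  assert (H : is_lim_seq (sum_n b) B) by exact HB.
  apply is_lim_seq_spec in H. destruct (H eps) as [N HN].
  exists (Nat.max N i0), (B - sum_n b (Nat.max N i0)).
  split; [lia|]. split.
  - apply (is_series_incr_n b (S (Nat.max N i0))); [lia|].
    change (is_series b (B - sum_n b (Nat.max N i0) + sum_n b (Nat.max N i0))).
    now replace (B - sum_n b (Nat.max N i0) + sum_n b (Nat.max N i0)) with B by ring.
  - specialize (HN (Nat.max N i0) ltac:(lia)). apply Rabs_def2 in HN.
    destruct HN. lra.
Qed.

(** * Dominated convergence and interchange of summations *)

(** Tannery's theorem. Each [v n] is split at an index [J] beyond which the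
    majorant [b] has a small sum: the head converges as a finite sum, the tails are
    uniformly small. Domination is only asked for large [n] and [i], which is what
    the cotangent expansion provides. *)
Lemma dominated_convergence (v : nat -> nat -> C) (w : nat -> C) (s : nat -> C)
    (b : nat -> R) (i0 : nat) :
  (forall n, is_series (v n) (s n)) ->
  (forall i, Clim (fun n => v n i) (w i)) ->
  ex_series b ->
  eventually (fun n => forall i, (i0 <= i)%nat -> Cmod (v n i) <= b i) ->
  exists l, is_series w l /\ Clim s l.
Proof.
  intros Hs Hw Hb [n0 Hn0].
  assert (Hwb : forall i, (i0 <= i)%nat -> Cmod (w i) <= b i).
  { intros i Hi.
    apply (is_lim_seq_le_loc (fun n => Cmod (v n i)) (fun _ => b i)
             (Cmod (w i)) (b i)).
    - exists n0. intros n Hn. now apply Hn0.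
    - now apply Clim_Cmod.
    - apply is_lim_seq_const. }
  assert (Hex : ex_series w).
  { apply (ex_series_incr_n w (S i0)).
    apply (ex_series_Cle _ (fun k => b (S i0 + k)%nat)).
    - intros k. apply Hwb. lia.
    - now apply (ex_series_incr_n b (S i0)). }
  destruct Hex as [l Hl]. exists l. split; [exact Hl|].
  apply Clim_eps. intros eps.
  assert (He4 : 0 < eps / 4) by (pose proof (cond_pos eps); lra).
  set (e4 := mkposreal (eps / 4) He4).
  (* The tail contributes at most twice the tail of b, hence eps / 2. *)
  destruct (series_tail_small b i0 e4 Hb) as [J [B [HJ [HB HBe]]]].
  assert (H1 := proj1 (Clim_eps _ _) (Clim_sum_n v w J Hw) e4).
  destruct H1 as [n1 Hn1].
  exists (Nat.max n0 n1). intros n Hn.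
  assert (Htail : Cmod ((s n - sum_n (v n) J) - (l - sum_n w J))%C <= 2 * B).
  { apply (Cmod_series_le (fun k => v n (S J + k)%nat - w (S J + k)%nat)%C
             (fun k => 2 * b (S J + k)%nat)).
    - intros k. unfold Cminus. apply Rle_trans with (1 := Cmod_triangle _ _).
      rewrite Cmod_opp. specialize (Hn0 n ltac:(lia) (S J + k)%nat ltac:(lia)).
      specialize (Hwb (S J + k)%nat ltac:(lia)). lra.
    - apply is_series_Cminus; now apply is_series_Ctail.
    - exact (is_series_scal 2 _ _ HB). }
  replace (s n - l)%C with
    (((s n - sum_n (v n) J) - (l - sum_n w J)) + (sum_n (v n) J - sum_n w J))%C
    by ring.
  apply Rle_lt_trans with (1 := Cmod_triangle _ _).
  specialize (Hn1 n ltac:(lia)). simpl in *.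
  pose proof (cond_pos eps). lra.
Qed.

(** Dominated convergence for the partial row sums, with the row sums [s] of [b]
    as majorant. *)
Lemma fubini (u : nat -> nat -> C) (b : nat -> nat -> R) (s : nat -> R)
    (rows columns : nat -> C) :
  (forall i j, Cmod (u i j) <= b i j) ->
  (forall i, is_series (b i) (s i)) ->
  ex_series s ->
  (forall i, is_series (u i) (rows i)) ->
  (forall j, is_series (fun i => u i j) (columns j)) ->
  exists l, is_series rows l /\ is_series columns l.
Proof.
  intros Hb Hs Hex Hrows Hcols.
  assert (Hb0 : forall i j, 0 <= b i j).
  { intros i j. apply Rle_trans with (2 := Hb i j). apply Cmod_ge_0. }
  apply (dominated_convergence (fun n i => sum_n (u i) n) rows
           (fun n => sum_n columns n) s 0).
  - intros n. induction n as [|n IH].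
    + rewrite sum_O. apply (is_series_ext (fun i => u i 0%nat)); [|apply Hcols].
      intros i. now rewrite sum_O.
    + rewrite sum_n_CS.
      apply (is_series_ext (fun i => sum_n (u i) n + u i (S n))%C).
      * intros i. now rewrite sum_n_CS.
      * now apply is_series_Cplus.
  - intros i. exact (Hrows i).
  - exact Hex.
  - exists 0%nat. intros n _ i _.
    apply Rle_trans with (1 := Cmod_sum_n_le _ _ n (Hb i)).
    now apply sum_n_le_series.
Qed.

(** * Convergence of the series of inverse powers *)

(** Discrete counterpart of the derivative of x^(-d), which makes the series of
    n^(-1-d) telescope. *)
Lemma Rpower_telescope (d : R) (n : nat) : 0 < d -> (1 <= n)%nat ->
  d * Rpower (INR (S n)) (- (1 + d))
  <= Rpower (INR n) (- d) - Rpower (INR (S n)) (- d).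
Proof.
  intros Hd Hn.
  assert (Hn0 : 0 < INR n) by (apply lt_0_INR; lia).
  assert (HSn : 0 < INR (S n)) by (apply lt_0_INR; lia).
  replace (- (1 + d)) with (- d + - (1)) by ring.
  rewrite Rpower_plus, (Rpower_Ropp _ 1), Rpower_1 by assumption.
  replace (Rpower (INR n) (- d)) with
    (Rpower (INR (S n)) (- d) * exp (d * (ln (INR (S n)) - ln (INR n)))).
  2:{ unfold Rpower. rewrite <- exp_plus. f_equal. ring. }
  (* exp (-x) >= 1 - x with x = ln ((n+1)/n) gives ln ((n+1)/n) >= 1/(n+1). *)
  assert (Hln : / INR (S n) <= ln (INR (S n)) - ln (INR n)).
  { assert (H := exp_ineq1_le (- (ln (INR (S n)) - ln (INR n)))).
    replace (exp (- (ln (INR (S n)) - ln (INR n)))) with (INR n / INR (S n)) in H.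
    2:{ rewrite Ropp_minus_distr. unfold Rminus. rewrite exp_plus, exp_Ropp, !exp_ln by assumption. reflexivity. }
    replace (INR n / INR (S n)) with (1 - / INR (S n)) in H; [lra|].
    rewrite S_INR in *. field. lra. }
  assert (He := exp_ineq1_le (d * (ln (INR (S n)) - ln (INR n)))).
  assert (Hp : 0 < Rpower (INR (S n)) (- d)) by apply exp_pos.
  assert (d * / INR (S n) <= d * (ln (INR (S n)) - ln (INR n)))
    by (apply Rmult_le_compat_l; lra).
  nra.
Qed.

Lemma ex_series_Rpower (p : R) : 1 < p ->
  ex_series (fun n => Rpower (INR (S n)) (- p)).
Proof.
  intros Hp. set (d := p - 1).
  assert (Hd : 0 < d) by (unfold d; lra).
  assert (Hbound : forall n, sum_n (fun n => Rpower (INR (S n)) (- p)) n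
            <= 1 + / d - / d * Rpower (INR (S n)) (- d)).
  { induction n as [|n IH].
    - rewrite sum_O. simpl. unfold Rpower. rewrite ln_1, !Rmult_0_r, exp_0. lra.
    - rewrite sum_n_RS.
      assert (H := Rpower_telescope d (S n) Hd ltac:(lia)).
      replace (1 + d) with p in H by (unfold d; ring).
      assert (H' : / d * (d * Rpower (INR (S (S n))) (- p))
         <= / d * (Rpower (INR (S n)) (- d) - Rpower (INR (S (S n))) (- d))).
      { apply Rmult_le_compat_l; [|exact H]. now left; apply Rinv_0_lt_compat. }
      rewrite <- Rmult_assoc, Rinv_l, Rmult_1_l in H' by lra. lra. }
  destruct (ex_finite_lim_seq_incr (sum_n (fun n => Rpower (INR (S n)) (- p)))
              (1 + / d)) as [l Hl].
  - intros n. rewrite sum_n_RS. assert (0 < Rpower (INR (S (S n))) (- p)) by apply exp_pos. lra.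
  - intros n. apply Rle_trans with (1 := Hbound n).
    assert (0 < / d * Rpower (INR (S n)) (- d)).
    { apply Rmult_lt_0_compat; [now apply Rinv_0_lt_compat | apply exp_pos]. }
    lra.
  - exists l. exact Hl.
Qed.

Lemma ex_series_inv_pow (q : nat) : (2 <= q)%nat ->
  ex_series (fun j => / INR (S j) ^ q).
Proof.
  intros Hq.
  apply (ex_series_le (V := R_CompleteNormedModule) _
           (fun n => Rpower (INR (S n)) (- (2)))).
  - intros j. assert (Hj := INR_S_ge_1 j).
    assert (H2 : 0 < INR (S j) ^ 2) by (apply pow_lt; lra).
    change (Rabs (/ INR (S j) ^ q) <= Rpower (INR (S j)) (- (2))).
    replace (Rpower (INR (S j)) (- (2))) with (/ INR (S j) ^ 2).
    2:{ rewrite Rpower_Ropp. change 2 with (INR 2).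
        rewrite Rpower_pow; [reflexivity|lra]. }
    rewrite Rabs_pos_eq.
    + apply Rinv_le_contravar; [exact H2|]. now apply Rle_pow.
    + left. apply Rinv_0_lt_compat, pow_lt. lra.
  - apply ex_series_Rpower. lra.
Qed.

(** * Complex exponential and trigonometric functions *)

Lemma Cexp_plus (a b : C) : Cexp (a + b) = (Cexp a * Cexp b)%C.
Proof.
  destruct a as [a1 a2], b as [b1 b2]. unfold Cexp. simpl.
  rewrite exp_plus, cos_plus, sin_plus.
  apply injective_projections; simpl; ring.
Qed.

Lemma Cexp_0 : Cexp 0 = 1%C.
Proof.
  unfold Cexp. simpl. rewrite exp_0, cos_0, sin_0.
  apply injective_projections; simpl; ring.
Qed.

Lemma Cexp_neq_0 (a : C) : Cexp a <> 0%C.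
Proof.
  intros H. apply C1_nz. rewrite <- Cexp_0.
  replace (RtoC 0) with (a + - a)%C by ring.
  rewrite Cexp_plus, H. ring.
Qed.

Lemma Cexp_opp (a : C) : Cexp (- a) = (/ Cexp a)%C.
Proof.
  assert (Ha := Cexp_neq_0 a).
  assert (H : (Cexp (- a) * Cexp a = 1)%C).
  { rewrite <- Cexp_plus, <- Cexp_0. f_equal. ring. }
  rewrite <- (Cmult_1_l (/ Cexp a)), <- H. field. exact Ha.
Qed.

Lemma Cexp_pow (a : C) (n : nat) : Cexp (RtoC (INR n) * a) = (Cexp a ^ n)%C.
Proof.
  induction n as [|n IH].
  - simpl. rewrite Cmult_0_l. apply Cexp_0.
  - rewrite Cpow_S, <- IH, <- Cexp_plus, S_INR, RtoC_plus. f_equal. ring.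
Qed.

Lemma Cmod_Cexp (a : C) : Cmod (Cexp a) = exp (Re a).
Proof.
  unfold Cexp, Cmod. simpl.
  replace (_ + _) with (exp (Re a) * exp (Re a) * ((sin (Im a))² + (cos (Im a))²))
    by (unfold Rsqr; ring).
  rewrite sin2_cos2, Rmult_1_r. apply sqrt_square. left; apply exp_pos.
Qed.

Lemma Cexp_2PI_Ci : Cexp (2 * PI * Ci) = 1%C.
Proof.
  unfold Cexp. simpl.
  replace ((2 * PI - 0 * 0) * 0 - (2 * 0 + 0 * PI) * 1) with 0 by ring.
  replace ((2 * PI - 0 * 0) * 1 + (2 * 0 + 0 * PI) * 0) with (2 * PI) by ring.
  rewrite exp_0, cos_2PI, sin_2PI.
  apply injective_projections; simpl; ring.
Qed.

Lemma Cexp_PI_Ci : Cexp (PI * Ci) = (- (1))%C.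
Proof.
  unfold Cexp. simpl.
  replace (PI * 0 - 0 * 1) with 0 by ring.
  replace (PI * 1 + 0 * 0) with PI by ring.
  rewrite exp_0, cos_PI, sin_PI.
  apply injective_projections; simpl; ring.
Qed.

(** exp(2iz) has modulus exp(-2 Im z), hence is not 1. This keeps cot z clear of its
    poles, all of which are real. *)
Lemma Cexp_sqr_neq_1 (z : C) : Im z <> 0 ->
  (Cexp (Ci * z) * Cexp (Ci * z) - 1 <> 0)%C.
Proof.
  intros Hz H.
  assert (H1 : (Cexp (Ci * z + Ci * z) = 1)%C).
  { rewrite Cexp_plus. replace (RtoC 1) with (0 + 1)%C by ring. rewrite <- H. ring. }
  assert (H2 : Cmod (Cexp (Ci * z + Ci * z)) = 1) by (rewrite H1; apply Cmod_1).
  rewrite Cmod_Cexp in H2. rewrite <- exp_0 in H2. apply exp_inv in H2.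
  apply Hz. destruct z as [x y]. simpl in *. lra.
Qed.

Lemma Csin_exp (z : C) :
  Csin z = ((Cexp (Ci * z) * Cexp (Ci * z) - 1) / (2 * Ci * Cexp (Ci * z)))%C.
Proof.
  unfold Csin. rewrite Cexp_opp.
  assert (H := Cexp_neq_0 (Ci * z)). field.
  auto using Ci_neq_0, C2_neq_0.
Qed.

Lemma Csin_neq_0 (z : C) : Im z <> 0 -> Csin z <> 0%C.
Proof.
  intros Hz H. rewrite Csin_exp in H. apply (Cexp_sqr_neq_1 z Hz).
  assert (Hd : (2 * Ci * Cexp (Ci * z) <> 0)%C).
  { repeat apply Cmult_neq_0; auto using Ci_neq_0, C2_neq_0, Cexp_neq_0. }
  replace (Cexp (Ci * z) * Cexp (Ci * z) - 1)%C with
    ((Cexp (Ci * z) * Cexp (Ci * z) - 1) / (2 * Ci * Cexp (Ci * z))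
      * (2 * Ci * Cexp (Ci * z)))%C by (field; auto using Ci_neq_0, C2_neq_0, Cexp_neq_0).
  rewrite H. ring.
Qed.

Lemma Ccot_exp (z : C) : Im z <> 0 ->
  Ccot z = (Ci * (Cexp (Ci * z) * Cexp (Ci * z) + 1)
               / (Cexp (Ci * z) * Cexp (Ci * z) - 1))%C.
Proof.
  intros Hz. unfold Ccot. rewrite Csin_exp. unfold Ccos. rewrite Cexp_opp.
  assert (H := Cexp_neq_0 (Ci * z)). assert (H' := Cexp_sqr_neq_1 z Hz).
  field. auto using Ci_neq_0, C2_neq_0.
Qed.

Lemma Csin_plus (a b : C) :
  Csin (a + b) = (Csin a * Ccos b + Ccos a * Csin b)%C.
Proof.
  unfold Csin, Ccos. rewrite !Cmult_plus_distr_l, !Copp_plus_distr, !Cexp_plus.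
  field. auto using Ci_neq_0, C2_neq_0.
Qed.

(** Separates the complex argument [a] from the real argument [b] in the denominator
    of cot(a+b) + cot(a-b). *)
Lemma Csin_plus_minus (a b : C) :
  (Csin (a + b) * Csin (a - b) = Csin a * Csin a - Csin b * Csin b)%C.
Proof.
  unfold Csin.
  replace (Ci * (a - b))%C with (Ci * a + - (Ci * b))%C by ring.
  replace (- (Ci * a + - (Ci * b)))%C with (- (Ci * a) + Ci * b)%C by ring.
  replace (Ci * (a + b))%C with (Ci * a + Ci * b)%C by ring.
  rewrite !Copp_plus_distr, !Cexp_plus, !Cexp_opp.
  assert (Ha := Cexp_neq_0 (Ci * a)). assert (Hb := Cexp_neq_0 (Ci * b)).
  field. auto using Ci_neq_0, C2_neq_0.
Qed.

Lemma Ccot_plus (a b : C) : Csin a <> 0%C -> Csin b <> 0%C ->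
  (Ccot a + Ccot b = Csin (a + b) / (Csin a * Csin b))%C.
Proof.
  intros Ha Hb. rewrite Csin_plus. unfold Ccot. field. auto.
Qed.

Lemma Csin_re_im (x y : R) : Csin (x, y) = (sin x * cosh y, cos x * sinh y).
Proof.
  unfold Csin, Cexp. simpl.
  replace (0 * x - 1 * y) with (- y) by ring.
  replace (0 * y + 1 * x) with x by ring.
  rewrite Ropp_involutive, cos_neg, sin_neg.
  unfold cosh, sinh. unfold Cdiv, Cinv, Cminus, Cplus, Copp, Cmult. simpl.
  apply injective_projections; simpl; field.
Qed.

Lemma Ccos_re_im (x y : R) : Ccos (x, y) = (cos x * cosh y, - (sin x * sinh y)).
Proof.
  unfold Ccos, Cexp. simpl.
  replace (0 * x - 1 * y) with (- y) by ring.
  replace (0 * y + 1 * x) with x by ring.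
  rewrite Ropp_involutive, cos_neg, sin_neg.
  unfold cosh, sinh. unfold Cdiv, Cinv, Cminus, Cplus, Copp, Cmult. simpl.
  apply injective_projections; simpl; field.
Qed.

Lemma Csin_RtoC (x : R) : Csin (RtoC x) = RtoC (sin x).
Proof.
  unfold RtoC at 1. rewrite Csin_re_im, sinh_0. unfold cosh.
  rewrite Ropp_0, exp_0. apply injective_projections; simpl; field.
Qed.

Lemma sin_ge_third (x : R) : 0 <= x <= PI / 2 -> x / 3 <= sin x.
Proof.
  intros [H0 H1]. pose proof PI_RGT_0 as Hp. pose proof PI_4 as Hp4.
  assert (H := sin_bound x 0 H0 ltac:(lra)). destruct H as [H _].
  unfold sin_approx in H. simpl in H. unfold sin_term in H. simpl in H.
  apply Rle_trans with (2 := H).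
  apply Rle_trans with (x - x * (x * x) / 6); [|right; field].
  assert (x * x <= 2 * 2) by (apply Rmult_le_compat; lra). nra.
Qed.

Lemma is_lim_seq_derive_0 (f : R -> R) (d : R) (N : nat -> R) :
  is_derive f 0 d -> f 0 = 0 -> (forall n, 0 < N n) ->
  is_lim_seq N p_infty -> is_lim_seq (fun n => N n * f (/ N n)) d.
Proof.
  intros Hd Hf HN Hlim. apply is_derive_Reals in Hd.
  apply is_lim_seq_spec. intros eps.
  destruct (Hd eps (cond_pos eps)) as [delta Hdelta].
  apply is_lim_seq_spec in Hlim. destruct (Hlim (/ delta)) as [n0 Hn0].
  exists n0. intros n Hn. specialize (Hn0 n Hn).
  assert (HNn := HN n). assert (Hdp := cond_pos delta).
  assert (Hi : 0 < / N n) by now apply Rinv_0_lt_compat.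
  replace (N n * f (/ N n)) with ((f (0 + / N n) - f 0) / (/ N n)).
  2:{ rewrite Rplus_0_l, Hf. field. lra. }
  apply Hdelta; [lra|].
  rewrite Rabs_pos_eq by lra.
  rewrite <- (Rinv_inv delta). apply Rinv_lt_contravar; [|exact Hn0].
  apply Rmult_lt_0_compat; [|lra]. now apply Rinv_0_lt_compat.
Qed.

Lemma is_lim_seq_continuous_0 (f : R -> R) (N : nat -> R) :
  ex_derive f 0 -> is_lim_seq N p_infty ->
  is_lim_seq (fun n => f (/ N n)) (f 0).
Proof.
  intros Hf Hlim.
  apply (is_lim_seq_continuous f (fun n => / N n) 0).
  - apply derivable_continuous_pt. now apply ex_derive_Reals_0.
  - apply (is_lim_seq_inv _ _ Hlim). discriminate.
Qed.

Lemma Clim_Csin_scaled (x : C) (N : nat -> R) :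
  (forall n, 0 < N n) -> is_lim_seq N p_infty ->
  Clim (fun n => RtoC (N n) * Csin (x / RtoC (N n)))%C x.
Proof.
  intros HN Hlim. destruct x as [x y].
  apply (Clim_ext (fun n => (N n * (sin (/ N n * x) * cosh (/ N n * y)),
                             N n * (cos (/ N n * x) * sinh (/ N n * y))))).
  - intros n. specialize (HN n).
    replace ((x, y) / RtoC (N n))%C with ((/ N n * x, / N n * y) : C).
    2:{ apply injective_projections; simpl; field; lra. }
    rewrite Csin_re_im. apply injective_projections; simpl; ring.
  - apply Clim_components. split; simpl.
    + apply (is_lim_seq_derive_0 (fun t => sin (t * x) * cosh (t * y)));
        [ | now rewrite !Rmult_0_l, sin_0, Rmult_0_l | assumption | assumption ].
      unfold cosh. auto_derive; [trivial|].
      rewrite !Rmult_0_l, sin_0, cos_0, Ropp_0, exp_0. field.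
    + apply (is_lim_seq_derive_0 (fun t => cos (t * x) * sinh (t * y)));
        [ | now rewrite !Rmult_0_l, sinh_0, Rmult_0_r | assumption | assumption ].
      unfold sinh. auto_derive; [trivial|].
      rewrite !Rmult_0_l, sin_0, cos_0, Ropp_0, exp_0. field.
Qed.

Lemma Clim_Ccos_scaled (x : C) (N : nat -> R) :
  (forall n, 0 < N n) -> is_lim_seq N p_infty ->
  Clim (fun n => Ccos (x / RtoC (N n)))%C 1%C.
Proof.
  intros HN Hlim. destruct x as [x y].
  apply (Clim_ext (fun n => (cos (/ N n * x) * cosh (/ N n * y),
                             - (sin (/ N n * x) * sinh (/ N n * y))))).
  - intros n. specialize (HN n).
    replace ((x, y) / RtoC (N n))%C with ((/ N n * x, / N n * y) : C).
    2:{ apply injective_projections; simpl; field; lra. }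
    now rewrite Ccos_re_im.
  - apply Clim_components. split; simpl.
    + replace 1 with (cos (0 * x) * cosh (0 * y)).
      2:{ unfold cosh. rewrite !Rmult_0_l, cos_0, Ropp_0, exp_0. field. }
      apply (is_lim_seq_continuous_0 (fun t => cos (t * x) * cosh (t * y))); [|assumption].
      unfold cosh. now auto_derive.
    + replace 0 with (- (sin (0 * x) * sinh (0 * y))).
      2:{ rewrite !Rmult_0_l, sin_0. ring. }
      apply (is_lim_seq_continuous_0 (fun t => - (sin (t * x) * sinh (t * y)))); [|assumption].
      unfold sinh. now auto_derive.
Qed.

(** * Partial fractions of the cotangent *)

Definition pcot (z : C) : C := (RtoC PI * Ccot (RtoC PI * z))%C.

Lemma Im_PI_mult (z : C) : Im z <> 0 -> Im (RtoC PI * z)%C <> 0.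
Proof.
  intros Hz. simpl. pose proof PI_RGT_0. intros H'. apply Hz.
  destruct z as [x y]. simpl in *. nra.
Qed.

(** With t = exp(i pi z), both the period and the duplication formula of the cotangent
    become identities between rational functions of t. *)
Lemma pcot_exp (z : C) (t : C) : Im z <> 0 -> (t * t)%C = Cexp (2 * PI * Ci * z)%C ->
  (t * t - 1 <> 0)%C /\ pcot z = (RtoC PI * Ci * (t * t + 1) / (t * t - 1))%C.
Proof.
  intros Hz Ht. apply Im_PI_mult in Hz.
  assert (H := Cexp_sqr_neq_1 _ Hz). unfold pcot. rewrite Ccot_exp by exact Hz.
  assert (He : (t * t = Cexp (Ci * (PI * z)) * Cexp (Ci * (PI * z)))%C).
  { rewrite Ht, <- Cexp_plus. f_equal. ring. }
  rewrite <- He in *. split; [exact H|]. field. exact H.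
Qed.

Lemma pcot_add_1 (z : C) : Im z <> 0 -> pcot (z + 1) = pcot z.
Proof.
  intros Hz.
  set (t := Cexp (PI * Ci * z)).
  destruct (pcot_exp z t Hz) as [_ ->].
  { unfold t. rewrite <- Cexp_plus. f_equal. ring. }
  destruct (pcot_exp (z + 1) t) as [_ ->]; [| |reflexivity].
  { destruct z as [x y]. simpl in *. lra. }
  unfold t. rewrite <- Cexp_plus.
  replace (2 * PI * Ci * (z + 1))%C
    with ((PI * Ci * z + PI * Ci * z) + 2 * PI * Ci)%C by ring.
  rewrite (Cexp_plus _ (2 * PI * Ci)), Cexp_2PI_Ci. ring.
Qed.

Lemma pcot_double (z : C) : Im z <> 0 ->
  pcot z = ((pcot (z / 2) + pcot (z / 2 + 1 / 2)) / 2)%C.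
Proof.
  intros Hz.
  assert (Hz2 : Im (z / 2)%C <> 0).
  { destruct z as [x y]. simpl in *. lra. }
  assert (Hz3 : Im (z / 2 + 1 / 2)%C <> 0).
  { destruct z as [x y]. simpl in *. lra. }
  set (s := Cexp (PI * Ci * (z / 2))).
  set (t := (s * s)%C).
  assert (Hs : s <> 0%C) by apply Cexp_neq_0.
  assert (Ht : t = Cexp (PI * Ci * z)).
  { unfold t, s. rewrite <- Cexp_plus. f_equal. field. }
  destruct (pcot_exp z t Hz) as [H1 ->].
  { rewrite Ht, <- Cexp_plus. f_equal. ring. }
  destruct (pcot_exp (z / 2) s Hz2) as [H2 ->].
  { fold t. rewrite Ht. f_equal. field. }
  (* Moving from z/2 to z/2 + 1/2 replaces s by s' = i s, so t = s * s by - t. *)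
  set (s' := (s * Cexp (PI * Ci * (1 / 2)))%C).
  assert (Hs' : (s' * s' = - t)%C).
  { unfold s'. replace (s * Cexp (PI * Ci * (1 / 2)) * (s * Cexp (PI * Ci * (1 / 2))))%C
      with (t * (Cexp (PI * Ci * (1 / 2)) * Cexp (PI * Ci * (1 / 2))))%C
      by (unfold t; ring).
    rewrite <- Cexp_plus.
    replace (PI * Ci * (1 / 2) + PI * Ci * (1 / 2))%C with (PI * Ci)%C
      by field.
    rewrite Cexp_PI_Ci. ring. }
  destruct (pcot_exp (z / 2 + 1 / 2) s' Hz3) as [H3 ->].
  { rewrite Hs', Ht.
    replace (2 * PI * Ci * (z / 2 + 1 / 2))%C with (PI * Ci * z + PI * Ci)%C
      by field.
    rewrite Cexp_plus, Cexp_PI_Ci. ring. }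
  rewrite Hs' in *. fold t in H2 |- *.
  field. auto using C2_neq_0.
Qed.

Lemma pcot_shift (z w : C) (N : R) : 0 < N -> Im z <> 0 ->
  (w = z + RtoC N)%C -> pcot (w / RtoC N) = pcot (z / RtoC N).
Proof.
  intros HN Hz ->.
  rewrite <- (pcot_add_1 (z / RtoC N)) by (apply Im_div_R_neq_0; lra).
  f_equal. field. apply RtoC_neq_0. lra.
Qed.

(** Over the denominator 2N, points at distance N differ by one half. *)
Lemma pcot_halve (z w : C) (N : R) : 0 < N -> Im z <> 0 ->
  (w = z + RtoC N)%C ->
  pcot (z / RtoC N) = ((pcot (z / RtoC (2 * N)) + pcot (w / RtoC (2 * N))) / 2)%C.
Proof.
  intros HN Hz ->.
  rewrite (pcot_double (z / RtoC N)) by (apply Im_div_R_neq_0; lra).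
  assert (HN' : RtoC N <> 0%C) by (apply RtoC_neq_0; lra).
  rewrite RtoC_mult.
  replace (z / RtoC N / 2)%C with (z / (2 * RtoC N))%C by (field; auto).
  replace (z / (2 * RtoC N) + 1 / 2)%C with ((z + RtoC N) / (2 * RtoC N))%C
    by (field; auto).
  reflexivity.
Qed.

(** Points at the integers [j] and [-1-j]: the integers from [-M] to [M-1] are a
    system of residues modulo 2M, split into M such pairs. Each pair is symmetric about -1/2. *)
Definition pcot_pair (z : C) (N : R) (j : nat) : C :=
  (pcot ((z + RtoC (INR j)) / RtoC N) + pcot ((z - RtoC (INR (S j))) / RtoC N))%C.

(** 2^p - 1, in the form produced by the duplication step: pairs are numbered from 0
    and there are 2^p of them. *)
Fixpoint last_pair (p : nat) : nat :=
  match p with O => O | S q => (2 * last_pair q + 1)%nat end.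

Lemma last_pair_ge (p : nat) : (p <= last_pair p)%nat.
Proof. induction p as [|p IH]; simpl; lia. Qed.

(** Iterating the duplication formula gives the average of pi cot (pi (z + n) / N)
    over a complete system of residues n modulo N = 2^(p+1). In the induction step every
    point gives rise to itself and to its translate by N; periodicity allows the
    translate to be taken towards the other sign, so that the residues remain centred. *)
Lemma pcot_finite_sum (z : C) (p : nat) : Im z <> 0 ->
  pcot z = (/ RtoC (2 * INR (S (last_pair p)))
            * sum_n (pcot_pair z (2 * INR (S (last_pair p)))) (last_pair p))%C.
Proof.
  intros Hz. induction p as [|p IH].
  - simpl last_pair. rewrite sum_O. unfold pcot_pair. simpl INR.
    assert (H1 : pcot z = ((pcot (z / 2) + pcot (z / 2 + 1 / 2)) / 2)%C)
      by now apply pcot_double.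
    rewrite H1, Rmult_1_r.
    rewrite <- (pcot_shift (z - 1) (z + 1)%C 2); [ | lra | now rewrite Im_minus_R | ].
    + replace (z + 0)%C with z by ring.
      replace ((z + 1) / 2)%C with (z / 2 + 1 / 2)%C by field. C_eq. field.
    + ring.
  - rewrite IH. simpl last_pair. set (m := last_pair p).
    replace (m + (m + 0) + 1)%nat with (2 * m + 1)%nat by lia.
    set (M := INR (S m)).
    assert (HM : 0 < M) by apply INR_S_pos.
    replace (INR (S (2 * m + 1))) with (2 * M).
    2:{ unfold M. replace (S (2 * m + 1)) with (2 * S m)%nat by lia.
        now rewrite mult_INR. }
    rewrite sum_n_fold.
    rewrite (sum_n_ext_loc
               (fun j => pcot_pair z (2 * (2 * M)) j
                         + pcot_pair z (2 * (2 * M)) (2 * m + 1 - j)%nat)%C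
               (fun j => 2 * pcot_pair z (2 * M) j)%C m).
    + rewrite sum_n_Cscal. rewrite !RtoC_mult. C_eq. field.
      apply RtoC_neq_0. lra.
    + intros j Hj. unfold pcot_pair.
      assert (HI : INR (S (2 * m + 1 - j)) = 2 * M - INR j).
      { unfold M. rewrite !S_INR, minus_INR, plus_INR, mult_INR by lia. simpl. ring. }
      assert (HI' : INR (2 * m + 1 - j) = 2 * M - INR (S j)).
      { unfold M. rewrite !S_INR, minus_INR, plus_INR, mult_INR by lia. simpl. ring. }
      rewrite HI, HI'.
      rewrite (pcot_halve (z + RtoC (INR j)) (z + RtoC (INR j) + RtoC (2 * M))%C (2 * M));
        [ | lra | now rewrite Im_plus_R | reflexivity ].
      rewrite (pcot_halve (z - RtoC (INR (S j)))
                 (z + RtoC (2 * M - INR (S j)))%C (2 * M));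
        [ | lra | now rewrite Im_minus_R | rewrite RtoC_minus; ring ].
      rewrite (pcot_shift (z - RtoC (2 * M - INR j)) (z + RtoC (INR j) + RtoC (2 * M))%C
                 (2 * (2 * M)));
        [ | lra | now rewrite Im_minus_R | rewrite RtoC_minus, !RtoC_mult; ring ].
      C_eq. field.
Qed.

(** Near 0, pi cot (pi x) behaves like 1/x. *)
Lemma Clim_pcot_scaled (u : C) (N : nat -> R) :
  (forall n, 0 < N n) -> is_lim_seq N p_infty -> Im u <> 0 ->
  Clim (fun n => / RtoC (N n) * pcot (u / RtoC (N n)))%C (/ u)%C.
Proof.
  intros HN Hlim Hu.
  assert (HPI : RtoC PI <> 0%C) by (apply RtoC_neq_0, PI_neq0).
  set (x := (RtoC PI * u)%C).
  assert (Hx : x <> 0%C) by (apply Im_neq_0, Im_PI_mult, Hu).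
  apply (Clim_ext (fun n => RtoC PI * (Ccos (x / RtoC (N n))
                      * / (RtoC (N n) * Csin (x / RtoC (N n)))))%C).
  - intros n. assert (HNn := HN n). unfold pcot, Ccot.
    replace (RtoC PI * (u / RtoC (N n)))%C with (x / RtoC (N n))%C
      by (unfold x, Cdiv; ring).
    field. split.
    + apply Csin_neq_0, Im_div_R_neq_0; [lra|]. now apply Im_PI_mult.
    + apply RtoC_neq_0. lra.
  - replace (/ u)%C with (RtoC PI * (1 * / x))%C.
    2:{ unfold x. field. split; [now apply Im_neq_0 | exact HPI]. }
    apply Clim_mult; [apply Clim_const|]. apply Clim_mult.
    + now apply Clim_Ccos_scaled.
    + apply Clim_inv; [exact Hx|]. now apply Clim_Csin_scaled.
Qed.

(** Uniform bound of order 1/h^2, h = j + 1/2, for the contribution of a pair. With the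
    arguments written A + B and A - B, where A is of order 1/N and B = pi h / N,
    the sum of the cotangents is sin 2A / (sin^2 A - sin^2 B); its numerator is of order
    1/N and its denominator at least of order (h/N)^2. *)
Lemma pcot_pair_bound (z : C) (N c : R) (j : nat) :
  let A := (RtoC PI * (z - RtoC (1 / 2)) / RtoC N)%C in
  let h := INR j + 1 / 2 in
  Im z <> 0 -> 2 * h <= N ->
  Cmod (RtoC N * Csin A) <= c -> Cmod (RtoC N * Csin (A + A)) <= c ->
  2 * c ^ 2 <= h ^ 2 ->
  Cmod (/ RtoC N * pcot_pair z N j) <= 2 * PI * c / h ^ 2.
Proof.
  intros A h Hz HhN H1 H2 Hc.
  assert (Hh : 0 < h) by (unfold h; pose proof (pos_INR j); lra).
  assert (HPI := PI_RGT_0). assert (HPI3 := PI2_3_2).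
  assert (HN : 0 < N) by lra.
  assert (HNC : RtoC N <> 0%C) by (apply RtoC_neq_0; lra).
  (* The two points of the pair are A / pi + h / N and A / pi - h / N; twice h is
     at most N, so that B stays in [0, pi/2] where the sine is bounded below. *)
  set (B := PI * h / N).
  assert (HB : 0 <= B <= PI / 2).
  { unfold B. split.
    - left. apply Rdiv_lt_0_compat; [now apply Rmult_lt_0_compat | exact HN].
    - apply (Rmult_le_reg_r N); [exact HN|].
      replace (PI * h / N * N) with (PI * h) by (field; lra). nra. }
  assert (HsinB : h <= N * sin B).
  { apply Rle_trans with (N * (B / 3)).
    - replace (N * (B / 3)) with (PI / 3 * h) by (unfold B; field; lra). nra.
    - apply Rmult_le_compat_l; [lra|]. now apply sin_ge_third. }
  assert (HBC : RtoC B = (RtoC PI * RtoC h / RtoC N)%C).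
  { unfold B. now rewrite RtoC_div, RtoC_mult by lra. }
  assert (Hj : RtoC (INR j) = (RtoC h - RtoC (1 / 2))%C).
  { rewrite <- RtoC_minus. f_equal. unfold h. ring. }
  assert (HSj : RtoC (INR (S j)) = (RtoC h + RtoC (1 / 2))%C).
  { rewrite <- RtoC_plus. f_equal. unfold h. rewrite S_INR. lra. }
  assert (Hplus : (RtoC PI * ((z + RtoC (INR j)) / RtoC N) = A + RtoC B)%C).
  { rewrite Hj, HBC. unfold A. field. exact HNC. }
  assert (Hminus : (RtoC PI * ((z - RtoC (INR (S j))) / RtoC N) = A - RtoC B)%C).
  { rewrite HSj, HBC. unfold A. field. exact HNC. }
  assert (Hs1 : Csin (A + RtoC B) <> 0%C).
  { rewrite <- Hplus. apply Csin_neq_0, Im_PI_mult, Im_div_R_neq_0; [lra|].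
    now rewrite Im_plus_R. }
  assert (Hs2 : Csin (A - RtoC B) <> 0%C).
  { rewrite <- Hminus. apply Csin_neq_0, Im_PI_mult, Im_div_R_neq_0; [lra|].
    now rewrite Im_minus_R. }
  (* D is N^2 (sin^2 B - sin^2 A): at least h^2 - c^2 in modulus. *)
  set (D := (RtoC (N * sin B) * RtoC (N * sin B)
             - (RtoC N * Csin A) * (RtoC N * Csin A))%C).
  assert (HD' : (D = - (RtoC N * RtoC N * (Csin (A + RtoC B) * Csin (A - RtoC B))))%C).
  { unfold D. rewrite Csin_plus_minus, Csin_RtoC, RtoC_mult. ring. }
  assert (HD0 : D <> 0%C).
  { rewrite HD'. intros H.
    assert (H' : (RtoC N * RtoC N * (Csin (A + RtoC B) * Csin (A - RtoC B)) <> 0)%C)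
      by (apply Cmult_neq_0; now apply Cmult_neq_0).
    apply H'. set (X := (RtoC N * RtoC N * (Csin (A + RtoC B) * Csin (A - RtoC B)))%C) in *.
    replace X with (- - X)%C by ring. rewrite H. ring. }
  assert (HD : h ^ 2 / 2 <= Cmod D).
  { assert (Ht := Cmod_triangle D ((RtoC N * Csin A) * (RtoC N * Csin A))).
    replace (D + RtoC N * Csin A * (RtoC N * Csin A))%C
      with (RtoC ((N * sin B) * (N * sin B))) in Ht
      by (unfold D; rewrite (RtoC_mult (N * sin B)); ring).
    rewrite Cmod_R, Cmod_mult in Ht.
    pose proof (Cmod_ge_0 (RtoC N * Csin A)).
    pose proof (Rle_abs ((N * sin B) * (N * sin B))). nra. }
  unfold pcot_pair, pcot. rewrite Hplus, Hminus, <- Cmult_plus_distr_l.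
  rewrite Ccot_plus by assumption.
  replace (A + RtoC B + (A - RtoC B))%C with (A + A)%C by ring.
  replace (/ RtoC N * (RtoC PI * (Csin (A + A)
             / (Csin (A + RtoC B) * Csin (A - RtoC B)))))%C
    with (- (RtoC PI * (RtoC N * Csin (A + A)) / D))%C.
  2:{ rewrite HD'. field. auto. }
  rewrite Cmod_opp, Cmod_div, Cmod_mult, Cmod_R by exact HD0.
  rewrite Rabs_pos_eq by lra.
  assert (Hh2 : 0 < h ^ 2) by now apply pow_lt.
  replace (2 * PI * c / h ^ 2) with (PI * c * / (h ^ 2 / 2)) by (field; lra).
  unfold Rdiv at 1. apply Rmult_le_compat.
  - apply Rmult_le_pos; [lra | apply Cmod_ge_0].
  - left. apply Rinv_0_lt_compat. lra.
  - apply Rmult_le_compat_l; lra.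
  - apply Rinv_le_contravar; lra.
Qed.

(** The limit of [pcot_finite_sum] as [p] grows, taken term by term. *)
Lemma pcot_paired_series (z : C) : Im z <> 0 ->
  is_series (fun j => / (z + RtoC (INR j)) + / (z - RtoC (INR (S j))))%C (pcot z).
Proof.
  intros Hz.
  set (N := fun p => 2 * INR (S (last_pair p))).
  assert (HN : forall p, 0 < N p).
  { intros p. unfold N. pose proof (INR_S_pos (last_pair p)). lra. }
  assert (Hlim : is_lim_seq N p_infty).
  { apply (is_lim_seq_le_p_loc INR); [|apply is_lim_seq_INR].
    exists 0%nat. intros p _. unfold N.
    pose proof (le_INR _ _ (last_pair_ge p)). rewrite S_INR. pose proof (pos_INR p). lra. }
  set (X := (RtoC PI * (z - RtoC (1 / 2)))%C).
  set (c := Cmod X + Cmod X + 1).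
  assert (HX := Cmod_ge_0 X).
  (* Beyond i0 the domination requirement 2 c^2 <= (j + 1/2)^2 holds. *)
  destruct (INR_unbounded (2 * c ^ 2)) as [i0 Hi0].
  set (v := fun p j => if Nat.leb j (last_pair p)
                       then (/ RtoC (N p) * pcot_pair z (N p) j)%C else 0%C).
  destruct (dominated_convergence v
              (fun j => / (z + RtoC (INR j)) + / (z - RtoC (INR (S j))))%C
              (fun _ => pcot z) (fun j => 2 * PI * c / (INR j + 1 / 2) ^ 2) (S i0))
    as [l [Hl Hs]].
  - intros p. apply (is_series_Cext (v p) _ (sum_n (v p) (last_pair p))); [reflexivity| |].
    + rewrite (pcot_finite_sum z p Hz), <- sum_n_Cscal.
      apply sum_n_ext_loc. intros j Hj. unfold v.
      apply Nat.leb_le in Hj. now rewrite Hj.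
    + apply is_series_finite. intros j Hj. unfold v.
      apply Nat.leb_gt in Hj. now rewrite Hj.
  - intros j.
    apply (Clim_ext_loc (fun p => / RtoC (N p) * pcot ((z + RtoC (INR j)) / RtoC (N p))
               + / RtoC (N p) * pcot ((z - RtoC (INR (S j))) / RtoC (N p)))%C).
    + exists j. intros p Hp. unfold v.
      assert (Hj : Nat.leb j (last_pair p) = true).
      { apply Nat.leb_le. pose proof (last_pair_ge p). lia. }
      rewrite Hj. unfold pcot_pair. ring.
    + apply Clim_plus; apply Clim_pcot_scaled; try assumption.
      * now rewrite Im_plus_R.
      * now rewrite Im_minus_R.
  - apply (ex_series_le (V := R_CompleteNormedModule) _
             (fun j => (8 * PI * c) * / INR (S j) ^ 2)).
    + intros j. pose proof PI_RGT_0 as HPI. pose proof (pos_INR j) as Hj.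
      match goal with |- norm ?x <= ?y => change (Rabs x <= y) end.
      rewrite Rabs_pos_eq.
      * replace (8 * PI * c) with ((2 * PI * c) * 4) by ring.
        unfold Rdiv at 1. rewrite (Rmult_assoc (2 * PI * c)). apply Rmult_le_compat_l.
        { unfold c. nra. }
        replace (4 * / INR (S j) ^ 2) with (/ ((INR j + 1) / 2) ^ 2)
          by (rewrite S_INR; field; lra).
        apply Rinv_le_contravar; [apply pow_lt; lra|]. apply pow_incr. lra.
      * apply Rmult_le_pos; [unfold c; nra|]. left.
        apply Rinv_0_lt_compat, pow_lt. lra.
    + apply (ex_series_scal_l (8 * PI * c : R_AbsRing) (fun j => / INR (S j) ^ 2)). apply ex_series_inv_pow. lia.
  - assert (L1 := Clim_Cmod _ _ (Clim_Csin_scaled X N HN Hlim)).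
    assert (L2 := Clim_Cmod _ _ (Clim_Csin_scaled (X + X) N HN Hlim)).
    apply is_lim_seq_spec in L1, L2.
    destruct (L1 (mkposreal 1 Rlt_0_1)) as [n1 Hn1].
    destruct (L2 (mkposreal 1 Rlt_0_1)) as [n2 Hn2].
    exists (Nat.max n1 n2). intros p Hp j Hj. unfold v.
    destruct (Nat.leb_spec j (last_pair p)) as [Hjp|Hjp].
    2:{ rewrite Cmod_0. unfold Rdiv. pose proof PI_RGT_0. pose proof (pos_INR j).
        apply Rmult_le_pos; [unfold c; nra|]. left.
        apply Rinv_0_lt_compat, pow_lt. lra. }
    specialize (Hn1 p ltac:(lia)). specialize (Hn2 p ltac:(lia)). simpl in Hn1, Hn2.
    apply Rabs_def2 in Hn1, Hn2.
    apply pcot_pair_bound; [exact Hz| | | |].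
    + unfold N. rewrite S_INR. apply le_INR in Hjp. lra.
    + fold X. unfold c. lra.
    + fold X. replace (X / RtoC (N p) + X / RtoC (N p))%C
        with ((X + X) / RtoC (N p))%C by (unfold Cdiv; ring).
      pose proof (Cmod_triangle X X). unfold c. lra.
    + apply le_INR in Hj. rewrite S_INR in Hj. pose proof (pos_INR i0). nra.
  - now rewrite (Clim_unique _ _ _ (Clim_const (pcot z)) Hs).
Qed.

(** Mittag-Leffler expansion of pi cot (pi z) off the real axis, obtained by pairing
    [l] with [-l] instead of [l] with [-1-l]. *)
Lemma pcot_partial_fractions (z : C) : Im z <> 0 ->
  is_series (fun j => 2 * z / (z * z - RtoC (INR (S j)) * RtoC (INR (S j))))%C
    (pcot z - / z)%C.
Proof.
  intros Hz.
  assert (Hp : forall x : R, (z + RtoC x <> 0)%C).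
  { intros x. apply Im_neq_0. now rewrite Im_plus_R. }
  assert (Hm : forall x : R, (z - RtoC x <> 0)%C).
  { intros x. apply Im_neq_0. now rewrite Im_minus_R. }
  assert (Hz0 := Im_neq_0 z Hz).
  (* The symmetric partial sum omits the term 1/z and contains the unpaired term
     1 / (z + n + 1), which tends to 0. *)
  set (P := fun j => (/ (z + RtoC (INR j)) + / (z - RtoC (INR (S j))))%C).
  apply is_series_Clim.
  apply (Clim_ext (fun n => sum_n P n + - / z + / (z + RtoC (INR (S n))))%C).
  - intros n. symmetry. induction n as [|n IH].
    + rewrite !sum_O. unfold P. simpl INR.
      specialize (Hp 1). specialize (Hm 1). replace (z + 0)%C with z by ring. C_eq. field.
      repeat split; try assumption.
      replace (z * z - 1)%C with ((z + 1) * (z - 1))%C by ring.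
      now apply Cmult_neq_0.
    + rewrite !sum_n_CS, IH. unfold P.
      pose proof (Hp (INR (S n))). pose proof (Hp (INR (S (S n)))).
      pose proof (Hm (INR (S (S n)))).
      set (y := RtoC (INR (S (S n)))) in *. set (x := RtoC (INR (S n))) in *.
      set (S0 := sum_n _ n). C_eq. field.
      repeat split; try assumption.
      replace (z * z - y * y)%C with ((z + y) * (z - y))%C by ring.
      now apply Cmult_neq_0.
  - replace (pcot z - / z)%C with (pcot z + - / z + 0)%C by ring.
    apply Clim_plus; [apply Clim_plus|].
    + now apply pcot_paired_series.
    + apply Clim_const.
    + apply Clim_eps. intros eps.
      destruct (INR_unbounded (Cmod z + / eps)) as [n0 Hn0].
      exists n0. intros n Hn.
      replace (/ (z + RtoC (INR (S n))) - 0)%C with (/ (z + RtoC (INR (S n))))%C by ring.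
      rewrite Cmod_inv by apply Hp.
      assert (Hie : 0 < / eps) by apply Rinv_0_lt_compat, cond_pos.
      rewrite <- (Rinv_inv eps).
      assert (/ eps < Cmod (z + RtoC (INR (S n)))).
      { assert (Ht := Cmod_triangle (z + RtoC (INR (S n))) (- z)).
        replace (z + RtoC (INR (S n)) + - z)%C with (RtoC (INR (S n))) in Ht by ring.
        rewrite Cmod_opp, Cmod_R, Rabs_pos_eq in Ht by apply pos_INR.
        apply le_INR in Hn. rewrite S_INR in Ht. rewrite S_INR. lra. }
      apply Rinv_lt_contravar; [|assumption].
      apply Rmult_lt_0_compat; lra.
Qed.

(** * Sums over the roots of -1 and the expansion of a_k *)

Lemma Cpow_0_r (x : C) : (x ^ 0 = 1)%C.
Proof. reflexivity. Qed.

Lemma Cpow_diff_factor (x y : C) (K : nat) :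
  ((x - y) * sum_n (fun s => x ^ s * y ^ (K - s)) K = x ^ S K - y ^ S K)%C.
Proof.
  induction K as [|K IH].
  - rewrite sum_O. simpl. ring.
  - rewrite sum_n_CS, Nat.sub_diag.
    rewrite (sum_n_ext_loc (fun s => x ^ s * y ^ (S K - s))%C
               (fun s => y * (x ^ s * y ^ (K - s)))%C K).
    + rewrite sum_n_Cscal.
      set (S0 := sum_n _ K) in *.
      transitivity (y * ((x - y) * S0) + (x - y) * x ^ S K)%C.
      * rewrite Cpow_0_r. ring.
      * rewrite IH. rewrite !Cpow_S. ring.
    + intros s Hs. replace (S K - s)%nat with (S (K - s)) by lia.
      rewrite Cpow_S. C_eq. ring.
Qed.

Lemma Cpow_geometric_sum (x : C) (K : nat) :
  ((x - 1) * sum_n (fun r => x ^ r) K = x ^ S K - 1)%C.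
Proof.
  rewrite <- (Cpow_1_l (S K)), <- Cpow_diff_factor. f_equal.
  - now rewrite Cpow_1_l.
  - apply sum_n_Cext. intros s. now rewrite Cpow_1_l, Cmult_1_r.
Qed.

(** exp(i pi / k); its odd powers are all the k-th roots of -1. The numbers epsilon of
    index k are odd powers of the root of index 2k. *)
Definition root_of_minus_one (k : nat) : C := Cexp (RtoC (PI / INR k) * Ci)%C.

Lemma root_of_minus_one_pow (k p : nat) : (1 <= k)%nat ->
  (root_of_minus_one k ^ p)%C = (cos (INR p * PI / INR k), sin (INR p * PI / INR k)).
Proof.
  intros Hk. assert (Hk' : 0 < INR k) by (apply lt_0_INR; lia).
  unfold root_of_minus_one. rewrite <- Cexp_pow. unfold Cexp. simpl.
  replace (INR p * (PI / INR k * 0 - 0 * 1) - 0 * (PI / INR k * 1 + 0 * 0)) with 0 by ring.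
  replace (INR p * (PI / INR k * 1 + 0 * 0) + 0 * (PI / INR k * 0 - 0 * 1))
    with (INR p * PI / INR k) by (field; lra).
  now rewrite exp_0, !Rmult_1_l.
Qed.

Lemma root_of_minus_one_pow_k (k : nat) : (1 <= k)%nat -> (root_of_minus_one k ^ k = - (1))%C.
Proof.
  intros Hk. assert (Hk' : 0 < INR k) by (apply lt_0_INR; lia).
  rewrite root_of_minus_one_pow by exact Hk.
  replace (INR k * PI / INR k) with PI by (field; lra).
  rewrite cos_PI, sin_PI. apply injective_projections; simpl; ring.
Qed.

Lemma root_of_minus_one_pow_Im (k p : nat) : (0 < p < k)%nat -> Im (root_of_minus_one k ^ p)%C <> 0.
Proof.
  intros Hp. rewrite root_of_minus_one_pow by lia. simpl.
  assert (Hk' : 0 < INR k) by (apply lt_0_INR; lia).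
  assert (Hp' : 0 < INR p) by (apply lt_0_INR; lia).
  assert (Hpk : INR p < INR k) by (apply lt_INR; lia).
  pose proof PI_RGT_0 as HPI.
  apply Rgt_not_eq, sin_gt_0.
  - apply Rdiv_lt_0_compat; nra.
  - apply (Rmult_lt_reg_r (INR k)); [exact Hk'|].
    replace (INR p * PI / INR k * INR k) with (INR p * PI) by (field; lra). nra.
Qed.

Lemma epsilon_root_of_minus_one (k r : nat) : (1 <= k)%nat ->
  epsilon k r = (root_of_minus_one (2 * k) ^ (2 * r + 1))%C.
Proof.
  intros Hk. assert (Hk' : 0 < INR k) by (apply lt_0_INR; lia).
  unfold epsilon, root_of_minus_one. rewrite <- Cexp_pow. f_equal.
  rewrite plus_INR, !mult_INR, RtoC_plus, RtoC_mult, RtoC_div, RtoC_mult.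
  - simpl INR. replace (1 + 1) with 2 by ring. field. apply RtoC_neq_0. lra.
  - simpl INR. lra.
Qed.

Lemma epsilon_sqr (k r : nat) : (1 <= k)%nat ->
  (epsilon k r * epsilon k r = root_of_minus_one k ^ (2 * r + 1))%C.
Proof.
  intros Hk. assert (Hk' : 0 < INR k) by (apply lt_0_INR; lia).
  rewrite epsilon_root_of_minus_one, <- Cpow_add_r, !root_of_minus_one_pow by lia.
  replace (INR (2 * r + 1 + (2 * r + 1)) * PI / INR (2 * k))
    with (INR (2 * r + 1) * PI / INR k); [reflexivity|].
  rewrite (mult_INR 2 k), (plus_INR (2 * r + 1) (2 * r + 1)). simpl (INR 2). field. lra.
Qed.

Lemma epsilon_Im (k r : nat) : (r < k)%nat -> Im (epsilon k r) <> 0.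
Proof. intros Hr. rewrite epsilon_root_of_minus_one by lia. apply root_of_minus_one_pow_Im. lia. Qed.

(** For p < k this is a geometric sum whose ratio exp(2 i pi p / k) is a k-th root of
    unity different from 1: the p-th power of exp(i pi / k) is not real. *)
Lemma roots_of_minus_one_power_sum (k p : nat) : (1 <= p <= k)%nat ->
  sum_n (fun r => (root_of_minus_one k ^ (2 * r + 1)) ^ p)%C (k - 1)
  = (if Nat.eqb p k then - RtoC (INR k) else RtoC 0)%C.
Proof.
  intros Hp. set (h := root_of_minus_one k).
  assert (Hh : (h ^ k = - (1))%C) by (apply root_of_minus_one_pow_k; lia).
  rewrite (sum_n_Cext _ (fun r => h ^ p * ((h ^ p * h ^ p) ^ r))%C).
  2:{ intros r. rewrite <- Cpow_add_r, <- !Cpow_mult_r, <- Cpow_add_r. f_equal. lia. }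
  rewrite sum_n_Cscal.
  destruct (Nat.eqb_spec p k) as [->|Hpk].
  - rewrite Hh. rewrite (sum_n_Cext _ (fun _ => RtoC 1)).
    2:{ intros r. replace (- (1) * - (1))%C with (RtoC 1) by ring. apply Cpow_1_l. }
    rewrite sum_n_Cconst. replace (S (k - 1)) with k by lia. C_eq. ring.
  - assert (Hi : Im (h ^ p)%C <> 0) by (apply root_of_minus_one_pow_Im; lia).
    assert (Hg := Cpow_geometric_sum (h ^ p * h ^ p) (k - 1)).
    replace (S (k - 1)) with k in Hg by lia.
    assert (Hx : ((h ^ p * h ^ p) ^ k = 1)%C).
    { rewrite Cpow_mult_l, <- Cpow_mult_r, Nat.mul_comm, Cpow_mult_r, Hh, <- Cpow_mult_l.
      replace (- (1) * - (1))%C with (RtoC 1) by ring. apply Cpow_1_l. }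
    rewrite Hx in Hg.
    set (S0 := sum_n _ (k - 1)) in *.
    assert (Hd : (h ^ p * h ^ p - 1 <> 0)%C).
    { replace (h ^ p * h ^ p - 1)%C with ((h ^ p + RtoC 1) * (h ^ p - RtoC 1))%C by ring.
      apply Cmult_neq_0; apply Im_neq_0; [rewrite Im_plus_R | rewrite Im_minus_R]; exact Hi. }
    assert (HS : @eq C S0 0%C).
    { replace S0 with (/ (h ^ p * h ^ p - 1) * ((h ^ p * h ^ p - 1) * S0))%C by (field; exact Hd).
      rewrite Hg. ring. }
    rewrite HS. C_eq. ring.
Qed.

(** The partial fraction identity behind the average over r: it is the logarithmic
    derivative of x^k + 1 in homogeneous form. *)
Lemma roots_of_minus_one_sum (k : nat) (a b : C) : (1 <= k)%nat ->
  (a ^ k + b ^ k <> 0)%C ->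
  sum_n (fun r => let zeta := root_of_minus_one k ^ (2 * r + 1) in
                  zeta / (zeta * a - b))%C (k - 1)
  = (RtoC (INR k) * a ^ (k - 1) / (a ^ k + b ^ k))%C.
Proof.
  intros Hk Hab.
  (* Since (zeta a)^k - b^k = - (a^k + b^k), zeta / (zeta a - b) is up to
     this factor a polynomial in zeta with exponents from 1 to k. *)
  rewrite (sum_n_Cext _ (fun r => - / (a ^ k + b ^ k)
      * sum_n (fun s => (root_of_minus_one k ^ (2 * r + 1)) ^ S s
                        * (a ^ s * b ^ (k - 1 - s))) (k - 1))%C).
  - rewrite sum_n_Cscal, sum_n_exchange.
    rewrite (sum_n_last _ (k - 1)).
    + rewrite (sum_n_Cext _ (fun i => (a ^ (k - 1) * b ^ (k - 1 - (k - 1)))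
         * (root_of_minus_one k ^ (2 * i + 1)) ^ S (k - 1))%C) by (intros; C_eq; ring).
      rewrite sum_n_Cscal, roots_of_minus_one_power_sum by lia.
      replace (S (k - 1)) with k by lia. rewrite Nat.eqb_refl, Nat.sub_diag.
      rewrite Cpow_0_r. C_eq. field. exact Hab.
    + intros s Hs.
      rewrite (sum_n_Cext _ (fun i => (a ^ s * b ^ (k - 1 - s))
         * (root_of_minus_one k ^ (2 * i + 1)) ^ S s)%C) by (intros; C_eq; ring).
      rewrite sum_n_Cscal, roots_of_minus_one_power_sum by lia.
      destruct (Nat.eqb_spec (S s) k); [lia|]. C_eq. ring.
  - intros r. cbv zeta. set (zeta := (root_of_minus_one k ^ (2 * r + 1))%C).
    assert (Hzk : (zeta ^ k = - (1))%C).
    { unfold zeta. rewrite <- Cpow_mult_r, Nat.mul_comm, Cpow_mult_r, root_of_minus_one_pow_k by exact Hk.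
      rewrite Cpow_add_r, Cpow_mult_r. replace ((- (1)) ^ 2)%C with (RtoC 1) by ring.
      rewrite Cpow_1_l. ring. }
    rewrite (sum_n_Cext _ (fun s => zeta * ((zeta * a) ^ s * b ^ (k - 1 - s)))%C).
    2:{ intros s. rewrite Cpow_S, Cpow_mult_l. C_eq. ring. }
    rewrite sum_n_Cscal.
    assert (Hf := Cpow_diff_factor (zeta * a) b (k - 1)).
    replace (S (k - 1)) with k in Hf by lia.
    rewrite Cpow_mult_l, Hzk in Hf.
    set (S0 := sum_n _ (k - 1)) in *.
    assert (Hd : (zeta * a - b <> 0)%C).
    { intros H. rewrite H in Hf. apply Hab.
      replace (a ^ k + b ^ k)%C with (- (- (1) * a ^ k - b ^ k))%C by ring.
      rewrite <- Hf. ring. }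
    replace (a ^ k + b ^ k)%C with (- ((zeta * a - b) * S0))%C by (rewrite Hf; ring).
    C_eq. field. split; [|exact Hd].
    intros H. rewrite H in Hf. apply Hab.
    replace (a ^ k + b ^ k)%C with (- (- (1) * a ^ k - b ^ k))%C by ring.
    rewrite <- Hf. ring.
Qed.

(** Averaging the cotangent expansions at epsilon_r w. The squares of the epsilon_r are
    the k-th roots of -1, and summing over them turns each pair of poles into the
    real rational term on the left. *)
Lemma a_k_series (k : nat) (w : R) : (1 <= k)%nat -> 0 < w ->
  is_series (fun j => RtoC (2 * w ^ (2 * k - 1) / (INR (S j) ^ (2 * k) + w ^ (2 * k))))
    (a_k k w - RtoC (/ w))%C.
Proof.
  intros Hk Hw.
  assert (Hk' : 0 < INR k) by (apply lt_0_INR; lia).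
  assert (HkC : RtoC (INR k) <> 0%C) by (apply RtoC_neq_0; lra).
  assert (HwC : RtoC w <> 0%C) by (apply RtoC_neq_0; lra).
  assert (Hz : forall r, (r <= k - 1)%nat -> Im (epsilon k r * RtoC w)%C <> 0).
  { intros r Hr. assert (He := epsilon_Im k r ltac:(lia)).
    destruct (epsilon k r) as [x y]. simpl in *. nra. }
  set (z := fun r => (epsilon k r * RtoC w)%C) in *.
  assert (H := is_series_sum_n
     (fun r j => epsilon k r * (2 * z r / (z r * z r - RtoC (INR (S j)) * RtoC (INR (S j)))))%C
     (fun r => epsilon k r * (pcot (z r) - / z r))%C (k - 1)
     (fun r Hr => is_series_Cscal (epsilon k r) _ _
        (pcot_partial_fractions (z r) (Hz r Hr)))).
  apply (is_series_Cscal (/ RtoC (INR k))) in H.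
  revert H. apply is_series_Cext.
  - intros j. set (l := INR (S j)).
    assert (Hl : 0 < l) by apply INR_S_pos.
    rewrite (sum_n_Cext _ (fun r => (2 * RtoC w) *
       (let zeta := root_of_minus_one k ^ (2 * r + 1) in
        zeta / (zeta * (RtoC w ^ 2) - RtoC l ^ 2)))%C).
    2:{ intros r. cbv zeta. rewrite <- epsilon_sqr by exact Hk. unfold z.
        replace (epsilon k r * epsilon k r * RtoC w ^ 2)%C
          with (epsilon k r * RtoC w * (epsilon k r * RtoC w))%C by ring.
        replace (RtoC l ^ 2)%C with (RtoC l * RtoC l)%C by ring.
        unfold Cdiv. C_eq. ring. }
    assert (Hp : 0 < l ^ (2 * k) + w ^ (2 * k)).
    { apply Rplus_lt_0_compat; now apply pow_lt. }
    rewrite sum_n_Cscal, roots_of_minus_one_sum; [ | exact Hk | ].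
    + rewrite <- !Cpow_mult_r, <- !RtoC_pow.
      rewrite RtoC_div, RtoC_mult, RtoC_plus by lra.
      replace (w ^ (2 * k - 1)) with (w * w ^ (2 * (k - 1))).
      2:{ replace (2 * k - 1)%nat with (S (2 * (k - 1))) by lia. reflexivity. }
      rewrite RtoC_mult.
      assert (Hs : (RtoC (l ^ (2 * k)) + RtoC (w ^ (2 * k)) <> 0)%C).
      { rewrite <- RtoC_plus. apply RtoC_neq_0. lra. }
      rewrite (Cplus_comm (RtoC (w ^ _))). C_eq. field. auto.
    + rewrite <- !Cpow_mult_r, <- !RtoC_pow, <- RtoC_plus.
      apply RtoC_neq_0. lra.
  - unfold a_k. fold (sum_n (fun r =>
       RtoC PI * epsilon k r * Ccot (RtoC PI * epsilon k r * RtoC w))%C (k - 1)).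
    rewrite (sum_n_ext_loc (fun r => epsilon k r * (pcot (z r) - / z r))%C
       (fun r => RtoC PI * epsilon k r * Ccot (RtoC PI * epsilon k r * RtoC w)
                 - RtoC (/ w))%C (k - 1)).
    + rewrite sum_n_Cminus.
      rewrite sum_n_Cconst. replace (S (k - 1)) with k by lia.
      set (S0 := sum_n _ (k - 1)). C_eq. field. exact HkC.
    + intros r Hr.
      assert (He : epsilon k r <> 0%C).
      { apply Im_neq_0, epsilon_Im. lia. }
      unfold pcot, z. rewrite RtoC_inv by lra.
      replace (RtoC PI * (epsilon k r * RtoC w))%C
        with (RtoC PI * epsilon k r * RtoC w)%C by ring.
      C_eq. field. auto.
Qed.

(** * Divisor sums and Dirichlet series *)

(** Inserting zeros between the terms of a series only repeats its partial sums. *)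
Lemma is_series_multiples {K : AbsRing} {V : NormedModule K}
    (F : nat -> V) (m : nat) (l : V) : (1 <= m)%nat ->
  is_series (fun i => F (m * S i)%nat) l ->
  is_series (fun j => if Nat.eqb (S j mod m) 0 then F (S j) else zero) l.
Proof.
  intros Hm H.
  set (u := fun j => if Nat.eqb (S j mod m) 0 then F (S j) else zero).
  (* G q is the sum of the first q terms of the series over multiples; the n-th
     partial sum of the sparse series has met (n + 1) / m multiples of m. *)
  set (G := fun q => match q with
                     | O => zero
                     | S i => sum_n (fun i => F (m * S i)%nat) i
                     end).
  assert (Hstep : forall q, plus (G q) (F (m * S q)%nat) = G (S q)).
  { intros [|q]; simpl G.
    - now rewrite sum_O, plus_zero_l.
    - now rewrite sum_Sn. }
  assert (HG : forall n, sum_n u n = G (S n / m)%nat).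
  { assert (Hnext : forall n, plus (G (n / m)%nat) (u n) = G (S n / m)%nat).
    { intros n. unfold u.
      pose proof (Nat.div_mod_eq n m) as E. pose proof (Nat.mod_upper_bound n m ltac:(lia)) as B.
      destruct (Nat.eq_dec (S (n mod m)) m) as [Em|Em].
      - assert (E1 : (S n = m * S (n / m))%nat) by nia.
        rewrite E1, (Nat.mul_comm m), Nat.Div0.mod_mul, Nat.div_mul by lia.
        rewrite Nat.mul_comm. apply Hstep.
      - assert (E1 : (n / m = S n / m)%nat).
        { apply (Nat.div_unique _ _ _ (S (n mod m))); lia. }
        assert (E2 : (S (n mod m) = S n mod m)%nat).
        { apply (Nat.mod_unique _ _ (n / m)); lia. }
        rewrite <- E1, <- E2. simpl. apply plus_zero_r. }
    induction n as [|n IH].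
    - rewrite sum_O, <- Hnext. rewrite Nat.Div0.div_0_l. symmetry. apply plus_zero_l.
    - now rewrite sum_Sn, IH, Hnext. }
  intros P HP. destruct (H P HP) as [N0 HN0].
  exists (m * S N0)%nat. intros n Hn. rewrite HG.
  assert (Hq : (S N0 <= S n / m)%nat).
  { apply Nat.div_le_lower_bound; lia. }
  destruct (S n / m)%nat as [|q]; [lia|]. simpl G. apply HN0. lia.
Qed.

Lemma fold_right_Cplus_init (x : C) (s : list C) :
  fold_right Cplus x s = (fold_right Cplus 0 s + x)%C.
Proof. induction s as [|a s IH]; simpl; [ring | rewrite IH; ring]. Qed.

Lemma sum_n_filter (p : nat -> bool) (g : nat -> C) (n : nat) :
  sum_n (fun i => if p (S i) then g (S i) else RtoC 0) n
  = fold_right Cplus (RtoC 0) (map g (filter p (seq 1 (S n)))).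
Proof.
  induction n as [|n IH].
  - rewrite sum_O. simpl. destruct (p 1%nat); simpl; [C_eq; ring | reflexivity].
  - rewrite sum_n_CS, IH, (seq_S (S n)), filter_app, map_app, fold_right_app.
    rewrite (fold_right_Cplus_init (fold_right _ _ _)).
    simpl (1 + S n)%nat. f_equal.
    simpl. destruct (p (S (S n))); simpl; [C_eq; ring | reflexivity].
Qed.

Lemma divisor_sum_series (g : nat -> C) (j : nat) :
  is_series (fun i => if Nat.eqb (S j mod S i) 0 then g (S i) else RtoC 0)
    (divisor_sum g (S j)).
Proof.
  unfold divisor_sum, divisors. rewrite <- (sum_n_filter (fun d => Nat.eqb (S j mod d) 0)).
  apply is_series_finite. intros i Hi.
  rewrite Nat.mod_small by lia. reflexivity.
Qed.

(** The exponent [alpha - q] is at most [alpha - 2], hence smaller than -1. *)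
Lemma dominated_ex_series (h : nat -> C) (alpha : R) (q : nat) :
  alpha < 1 -> (2 <= q)%nat -> dominated_by_power h alpha ->
  ex_series (fun j => Cmod (h (S j)) / INR (S j) ^ q).
Proof.
  intros Ha Hq [K HK].
  apply (ex_series_Rle _ (fun j => K * Rpower (INR (S j)) (- (2 - alpha)))).
  - intros j. assert (Hj := INR_S_ge_1 j).
    assert (H2 : 0 < INR (S j) ^ 2) by (apply pow_lt; lra).
    assert (Hqp : INR (S j) ^ 2 <= INR (S j) ^ q) by now apply Rle_pow.
    specialize (HK (S j) ltac:(lia)). pose proof (Cmod_ge_0 (h (S j))) as Hm.
    split.
    + apply Rmult_le_pos; [exact Hm|]. left. apply Rinv_0_lt_compat. lra.
    + replace (- (2 - alpha)) with (alpha + - (2)) by ring.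
      rewrite Rpower_plus, (Rpower_Ropp _ 2).
      replace (Rpower (INR (S j)) 2) with (INR (S j) ^ 2).
      2:{ change 2 with (INR 2). rewrite Rpower_pow; [reflexivity|lra]. }
      rewrite <- Rmult_assoc. apply Rmult_le_compat; [exact Hm | | exact HK |].
      * left. apply Rinv_0_lt_compat. lra.
      * now apply Rinv_le_contravar.
  - apply ex_series_Rscal, ex_series_Rpower. lra.
Qed.

Lemma nat_cpow_nat (n q : nat) : (1 <= n)%nat ->
  nat_cpow n (RtoC (INR q)) = RtoC (INR n ^ q).
Proof.
  intros Hn. unfold nat_cpow. rewrite Cexp_pow, RtoC_pow. f_equal.
  unfold Cexp. simpl. rewrite exp_ln, cos_0, sin_0 by (apply lt_0_INR; lia).
  apply injective_projections; simpl; ring.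
Qed.

Lemma dirichlet_L_series (h : nat -> C) (alpha : R) (q : nat) :
  alpha < 1 -> (2 <= q)%nat -> dominated_by_power h alpha ->
  is_series (fun j => h (S j) / RtoC (INR (S j) ^ q))%C
    (dirichlet_L (RtoC (INR q)) h).
Proof.
  intros Ha Hq Hh. unfold dirichlet_L, Csum_from1.
  apply (is_series_ext (fun j => h (S j) / nat_cpow (S j) (RtoC (INR q)))%C).
  { intros j. rewrite nat_cpow_nat by lia. reflexivity. }
  apply Csum_correct.
  apply (ex_series_Cle _ (fun j => Cmod (h (S j)) / INR (S j) ^ q)).
  - intros j. rewrite nat_cpow_nat by lia.
    assert (Hp : 0 < INR (S j) ^ q) by apply pow_lt, INR_S_pos.
    rewrite Cmod_div by (apply RtoC_neq_0; lra).
    rewrite Cmod_R, Rabs_pos_eq by lra. apply Rle_refl.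
  - now apply (dominated_ex_series h alpha).
Qed.

(** * The kernel 1 / (a^2k + b^2k) *)

(** The kernel of the triple series over (m, l, n), with [a = l m] and [b = n]; its
    symmetry in [a] and [b] is what makes the final value a square. *)
Definition kernel (k a b : nat) : R := / (INR a ^ (2 * k) + INR b ^ (2 * k)).

Definition kernel_multiples (k m n : nat) : R :=
  Series (fun l => kernel k (m * S l) n).

Lemma kernel_sym (k a b : nat) : kernel k a b = kernel k b a.
Proof. unfold kernel. now rewrite Rplus_comm. Qed.

Lemma kernel_bound (k a b : nat) : (1 <= a)%nat ->
  0 <= kernel k a b <= / INR a ^ (2 * k).
Proof.
  intros Ha. unfold kernel.
  assert (H1 : 0 < INR a ^ (2 * k)) by (apply pow_lt, lt_0_INR; lia).
  assert (H2 : 0 <= INR b ^ (2 * k)) by apply pow_le, pos_INR.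
  split.
  - left. apply Rinv_0_lt_compat. lra.
  - apply Rinv_le_contravar; lra.
Qed.

Lemma kernel_multiples_bound_term (k m n l : nat) : (1 <= m)%nat ->
  0 <= kernel k (m * S l) n <= / INR m ^ (2 * k) * / INR (S l) ^ (2 * k).
Proof.
  intros Hm. rewrite <- Rinv_mult, <- Rpow_mult_distr, <- mult_INR.
  apply kernel_bound. nia.
Qed.

Lemma kernel_multiples_series (k m n : nat) : (1 <= k)%nat -> (1 <= m)%nat ->
  is_series (fun l => kernel k (m * S l) n) (kernel_multiples k m n).
Proof.
  intros Hk Hm. apply Series_correct.
  apply (ex_series_Rle _ (fun l => / INR m ^ (2 * k) * / INR (S l) ^ (2 * k))).
  - intros l. now apply kernel_multiples_bound_term.
  - apply ex_series_Rscal, ex_series_inv_pow. lia.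
Qed.

Lemma kernel_multiples_bound (k m n : nat) : (1 <= k)%nat -> (1 <= m)%nat ->
  0 <= kernel_multiples k m n
  <= / INR m ^ (2 * k) * Series (fun l => / INR (S l) ^ (2 * k)).
Proof.
  intros Hk Hm.
  assert (Hs := kernel_multiples_series k m n Hk Hm). split.
  - apply Rle_trans with (kernel k (m * 1) n).
    + now apply (kernel_multiples_bound_term k m n 0).
    + apply (term_le_series (fun l => kernel k (m * S l) n) _ 0); [|exact Hs].
      intros l. now apply kernel_multiples_bound_term.
  - rewrite <- Series_scal_l. apply Series_le.
    + intros l. now apply kernel_multiples_bound_term.
    + apply ex_series_Rscal, ex_series_inv_pow. lia.
Qed.

(** The term 1/w of the expansion produces m L(4k) after summation over n; the rest is
    the part that survives in the outer series. *)
Lemma inner_term_split (f : nat -> C) (k m n : nat) :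
  (1 <= k)%nat -> (1 <= m)%nat -> (1 <= n)%nat ->
  inner_term f k m n
  = (RtoC (INR m) * (f n / RtoC (INR n ^ (4 * k)))
     + 2 * RtoC (INR m) * (f n / RtoC (INR n ^ (2 * k)) * RtoC (kernel_multiples k m n)))%C.
Proof.
  intros Hk Hm Hn.
  assert (Hm' : 0 < INR m) by (apply lt_0_INR; lia).
  assert (Hn' : 0 < INR n) by (apply lt_0_INR; lia).
  set (w := INR n / INR m).
  assert (Hw : 0 < w) by now apply Rdiv_lt_0_compat.
  (* Clearing the powers of m in the expansion at w = n / m turns l^2k + w^2k
     into (l m)^2k + n^2k. *)
  assert (Ha : (a_k k w - RtoC (/ w)
                = RtoC (2 * INR m * INR n ^ (2 * k - 1) * kernel_multiples k m n))%C).
  { apply (is_series_unique_C _ _ _ (a_k_series k w Hk Hw)).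
    apply is_series_RtoC.
    apply (is_series_ext (fun l => 2 * INR m * INR n ^ (2 * k - 1) * kernel k (m * S l) n)).
    - intros l. unfold kernel. rewrite mult_INR.
      assert (Hl := INR_S_pos l).
      assert (Hp : 0 < INR m ^ (2 * k)) by now apply pow_lt.
      assert (Hd : 0 < INR (S l) ^ (2 * k) + w ^ (2 * k)).
      { apply Rplus_lt_0_compat; now apply pow_lt. }
      assert (E : (INR m * INR (S l)) ^ (2 * k) + INR n ^ (2 * k)
                  = INR m ^ (2 * k) * (INR (S l) ^ (2 * k) + w ^ (2 * k))).
      { replace (INR n) with (INR m * w) by (unfold w; field; lra).
        rewrite !Rpow_mult_distr. ring. }
      rewrite E.
      assert (E2 : INR m * INR n ^ (2 * k - 1) = INR m ^ (2 * k) * w ^ (2 * k - 1)).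
      { replace (INR n) with (INR m * w) by (unfold w; field; lra).
        rewrite Rpow_mult_distr, <- Rmult_assoc. f_equal.
        replace (2 * k)%nat with (S (2 * k - 1)) at 2 by lia. reflexivity. }
      rewrite (Rmult_assoc 2), E2. change (@eq R
        (2 * (INR m ^ (2 * k) * w ^ (2 * k - 1)) *
          / (INR m ^ (2 * k) * (INR (S l) ^ (2 * k) + w ^ (2 * k))))
        (2 * w ^ (2 * k - 1) / (INR (S l) ^ (2 * k) + w ^ (2 * k)))).
      field. lra.
    - apply is_series_Rscal. now apply kernel_multiples_series. }
  unfold inner_term. fold w.
  replace (a_k k w) with (RtoC (/ w)
     + RtoC (2 * INR m * INR n ^ (2 * k - 1) * kernel_multiples k m n))%C
    by (rewrite <- Ha; ring).
  assert (E4 : INR n ^ (4 * k) = INR n * INR n ^ (4 * k - 1)).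
  { replace (4 * k)%nat with (S (4 * k - 1)) at 1 by lia. reflexivity. }
  assert (E42 : INR n ^ (4 * k - 1) = INR n ^ (2 * k) * INR n ^ (2 * k - 1)).
  { rewrite <- pow_add. f_equal. lia. }
  assert (P1 : RtoC (INR n ^ (2 * k)) <> 0%C) by (apply RtoC_neq_0, pow_nonzero; lra).
  assert (P2 : RtoC (INR n ^ (2 * k - 1)) <> 0%C) by (apply RtoC_neq_0, pow_nonzero; lra).
  assert (P3 : RtoC (INR n) <> 0%C) by (apply RtoC_neq_0; lra).
  assert (P4 : RtoC (INR m) <> 0%C) by (apply RtoC_neq_0; lra).
  rewrite <- RtoC_pow, E4, E42, !RtoC_mult.
  replace (RtoC (/ w)) with (RtoC (INR m) / RtoC (INR n))%C.
  2:{ rewrite <- RtoC_div by lra. f_equal. unfold w. field. lra. }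
  field. auto.
Qed.

(** Both sides are the double series of g(m) kernel (N, n) over the pairs with m dividing N,
    summed by rows and by columns. *)
Lemma divisor_switch (g f : nat -> C) (alpha : R) (k n : nat) :
  (forall N, (1 <= N)%nat -> f N = divisor_sum g N) ->
  alpha < 1 -> dominated_by_power g alpha -> (1 <= k)%nat ->
  exists s,
    is_series (fun i => g (S i) * RtoC (kernel_multiples k (S i) n))%C s /\
    is_series (fun j => f (S j) * RtoC (kernel k (S j) n))%C s.
Proof.
  intros Hf Ha Hg Hk.
  set (dvd := fun i j => Nat.eqb (S j mod S i) 0).
  apply (fubini
    (fun i j => if dvd i j then (g (S i) * RtoC (kernel k (S j) n))%C else RtoC 0)
    (fun i j => if dvd i j then Cmod (g (S i)) * kernel k (S j) n else 0)
    (fun i => Cmod (g (S i)) * kernel_multiples k (S i) n)).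
  - intros i j. destruct (dvd i j).
    + rewrite Cmod_mult, Cmod_R, Rabs_pos_eq; [apply Rle_refl|].
      apply kernel_bound. lia.
    + rewrite Cmod_0. apply Rle_refl.
  - intros i.
    apply (is_series_multiples (fun N => Cmod (g (S i)) * kernel k N n) (S i)); [lia|].
    apply is_series_Rscal. apply kernel_multiples_series; lia.
  - apply (ex_series_Rle _ (fun i => Series (fun l => / INR (S l) ^ (2 * k))
                                     * (Cmod (g (S i)) / INR (S i) ^ (2 * k)))).
    + intros i. destruct (kernel_multiples_bound k (S i) n Hk ltac:(lia)) as [H0 H1].
      pose proof (Cmod_ge_0 (g (S i))) as Hc. split; [now apply Rmult_le_pos|].
      apply Rle_trans with (1 := Rmult_le_compat_l _ _ _ Hc H1).
      right. unfold Rdiv. ring.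
    + apply ex_series_Rscal. apply (dominated_ex_series g alpha); [exact Ha | lia | exact Hg].
  - intros i.
    apply (is_series_multiples (fun N => g (S i) * RtoC (kernel k N n))%C (S i)); [lia|].
    apply is_series_Cscal, is_series_RtoC. apply kernel_multiples_series; lia.
  - intros j. rewrite Hf by lia. rewrite Cmult_comm.
    apply (is_series_Cext (fun i => RtoC (kernel k (S j) n)
              * (if dvd i j then g (S i) else RtoC 0))%C _
              (RtoC (kernel k (S j) n) * divisor_sum g (S j))%C); [|reflexivity|].
    + intros i. destruct (dvd i j); C_eq; ring.
    + apply is_series_Cscal. apply divisor_sum_series.
Qed.

(** * The square of the Dirichlet series *)

Theorem theorem4 (g f : nat -> C) (alpha : R)
  (f_eq : forall n : nat, (1 <= n)%nat -> f n = divisor_sum g n)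
  (alpha_bounds : 0 < alpha < 1)
  (f_bound : dominated_by_power f alpha)
  (g_bound : dominated_by_power g alpha)
  (k : nat) (k_pos : (1 <= k)%nat) :
  (forall m : nat, (1 <= m)%nat ->
     ex_series (fun j : nat => inner_term f k m (S j))) /\
  is_series
    (fun i : nat => let m := S i in
       (g m / RtoC (INR m)
        * (Csum_from1 (inner_term f k m)
           - RtoC (INR m) * dirichlet_L (RtoC (INR (4 * k))) f))%C)
    ((dirichlet_L (RtoC (INR (2 * k))) f) ^ 2)%C.
Proof.
  destruct alpha_bounds as [_ Ha].
  set (L := dirichlet_L (RtoC (INR (2 * k))) f).
  set (L4 := dirichlet_L (RtoC (INR (4 * k))) f).
  set (c := fun n => (f n / RtoC (INR n ^ (2 * k)))%C).
  set (H := kernel_multiples k).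
  set (zeta := Series (fun l => / INR (S l) ^ (2 * k))).
  assert (HL : is_series (fun j => c (S j)) L).
  { apply (dirichlet_L_series f alpha); [exact Ha | lia | exact f_bound]. }
  assert (HL4 : is_series (fun j => f (S j) / RtoC (INR (S j) ^ (4 * k)))%C L4).
  { apply (dirichlet_L_series f alpha); [exact Ha | lia | exact f_bound]. }
  assert (Hcmod : forall j, Cmod (c (S j)) = Cmod (f (S j)) / INR (S j) ^ (2 * k)).
  { intros j. assert (Hp : 0 < INR (S j) ^ (2 * k)) by apply pow_lt, INR_S_pos.
    unfold c. rewrite Cmod_div by (apply RtoC_neq_0; lra).
    now rewrite Cmod_R, Rabs_pos_eq by lra. }
  assert (Hcex : ex_series (fun j => Cmod (c (S j)))).
  { apply (ex_series_ext (fun j => Cmod (f (S j)) / INR (S j) ^ (2 * k))).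
    - intros j. now rewrite Hcmod.
    - apply (dominated_ex_series f alpha); [exact Ha | lia | exact f_bound]. }
  assert (HH : forall m j, (1 <= m)%nat ->
            Cmod (c (S j) * RtoC (H m (S j))) <= / INR m ^ (2 * k) * zeta * Cmod (c (S j))).
  { intros m j Hm. destruct (kernel_multiples_bound k m (S j) k_pos Hm) as [B0 B1].
    rewrite Cmod_mult, Cmod_R, Rabs_pos_eq by exact B0.
    rewrite Rmult_comm. apply Rmult_le_compat_r; [apply Cmod_ge_0 | exact B1]. }
  set (I := fun m => Csum (fun j => c (S j) * RtoC (H m (S j)))%C).
  assert (HI : forall m, (1 <= m)%nat ->
            is_series (fun j => c (S j) * RtoC (H m (S j)))%C (I m)).
  { intros m Hm. apply Csum_correct.
    apply (ex_series_Cle _ _ (fun j => HH m j Hm)). now apply ex_series_Rscal. }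
  assert (Hinner : forall m, (1 <= m)%nat ->
            is_series (fun j => inner_term f k m (S j))
              (RtoC (INR m) * L4 + 2 * RtoC (INR m) * I m)%C).
  { intros m Hm.
    apply (is_series_Cext (fun j =>
       RtoC (INR m) * (f (S j) / RtoC (INR (S j) ^ (4 * k)))
       + 2 * RtoC (INR m) * (c (S j) * RtoC (H m (S j))))%C _
       (RtoC (INR m) * L4 + 2 * RtoC (INR m) * I m)%C); [|reflexivity|].
    - intros j. symmetry. apply inner_term_split; lia.
    - apply is_series_Cplus; apply is_series_Cscal; [exact HL4 | now apply HI]. }
  split.
  { intros m Hm. eexists. now apply Hinner. }
  (* Sum over m first: the divisor switch replaces g and the sum over multiples of
     m by a sum against f. *)
  set (T := fun n => Csum (fun j => f (S j) * RtoC (kernel k (S j) n))%C).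
  assert (HT : forall n,
            is_series (fun j => f (S j) * RtoC (kernel k (S j) n))%C (T n) /\
            is_series (fun i => g (S i) * RtoC (H (S i) n))%C (T n)).
  { intros n. destruct (divisor_switch g f alpha k n f_eq Ha g_bound k_pos) as [s [H1 H2]].
    unfold T. rewrite (Csum_unique _ _ H2). now split. }
  destruct (fubini (fun i j => g (S i) * (c (S j) * RtoC (H (S i) (S j))))%C
     (fun i j => zeta * (Cmod (g (S i)) / INR (S i) ^ (2 * k)) * Cmod (c (S j)))
     (fun i => zeta * (Cmod (g (S i)) / INR (S i) ^ (2 * k))
               * Series (fun j => Cmod (c (S j))))
     (fun i => g (S i) * I (S i))%C (fun j => c (S j) * T (S j))%C) as [l [Hl1 Hl2]].
  { intros i j. rewrite Cmod_mult.
    apply Rle_trans with (1 := Rmult_le_compat_l _ _ _ (Cmod_ge_0 _)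
                                 (HH (S i) j ltac:(lia))).
    right. unfold Rdiv. ring. }
  { intros i. apply is_series_Rscal. now apply Series_correct. }
  { apply (ex_series_ext (fun i => (zeta * Series (fun j => Cmod (c (S j))))
              * (Cmod (g (S i)) / INR (S i) ^ (2 * k)))).
    - intros i. match goal with |- ?a = ?b => change (@eq R a b) end. ring.
    - apply ex_series_Rscal. apply (dominated_ex_series g alpha); [exact Ha | lia | exact g_bound]. }
  { intros i. apply is_series_Cscal, HI. lia. }
  { intros j. apply (is_series_Cext (fun i => c (S j) * (g (S i) * RtoC (H (S i) (S j))))%C _
       (c (S j) * T (S j))%C); [intros i; ring | reflexivity |].
    apply is_series_Cscal, HT. }
  (* The double series of c n * f N * kernel N n, summed in the two orders, gives
     l and L^2 - l. *)
  assert (Hsym : forall i j,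
     (c (S i) * c (S j) - c (S i) * (f (S j) * RtoC (kernel k (S j) (S i)))
      = c (S j) * (f (S i) * RtoC (kernel k (S i) (S j))))%C).
  { intros i j.
    assert (Hi : 0 < INR (S i) ^ (2 * k)) by apply pow_lt, INR_S_pos.
    assert (Hj : 0 < INR (S j) ^ (2 * k)) by apply pow_lt, INR_S_pos.
    rewrite (kernel_sym k (S j)). unfold c, kernel.
    rewrite RtoC_inv, RtoC_plus by lra.
    assert (N1 : RtoC (INR (S i) ^ (2 * k)) <> 0%C) by (apply RtoC_neq_0; lra).
    assert (N2 : RtoC (INR (S j) ^ (2 * k)) <> 0%C) by (apply RtoC_neq_0; lra).
    assert (N3 : (RtoC (INR (S i) ^ (2 * k)) + RtoC (INR (S j) ^ (2 * k)) <> 0)%C).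
    { rewrite <- RtoC_plus. apply RtoC_neq_0. lra. }
    field. auto. }
  destruct (fubini (fun j i => c (S j) * (f (S i) * RtoC (kernel k (S i) (S j))))%C
     (fun j i => Cmod (c (S j)) * Cmod (c (S i)))
     (fun j => Series (fun i => Cmod (c (S i))) * Cmod (c (S j)))
     (fun j => c (S j) * T (S j))%C
     (fun i => c (S i) * L - c (S i) * T (S i))%C) as [l' [Hl3 Hl4]].
  { intros j i. rewrite !Cmod_mult. apply Rmult_le_compat_l; [apply Cmod_ge_0|].
    destruct (kernel_bound k (S i) (S j) ltac:(lia)) as [B0 B1].
    rewrite Cmod_R, Rabs_pos_eq, Hcmod by exact B0.
    apply Rmult_le_compat_l; [apply Cmod_ge_0 | exact B1]. }
  { intros j. rewrite Rmult_comm. apply is_series_Rscal. now apply Series_correct. }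
  { now apply ex_series_Rscal. }
  { intros j. apply is_series_Cscal, HT. }
  { intros i. apply (is_series_Cext (fun j =>
       c (S i) * c (S j) - c (S i) * (f (S j) * RtoC (kernel k (S j) (S i))))%C _
       (c (S i) * L - c (S i) * T (S i))%C); [intros j; apply Hsym | reflexivity |].
    apply is_series_Cminus; apply is_series_Cscal; [exact HL | apply HT]. }
  rewrite (is_series_unique_C _ _ _ Hl3 Hl2) in Hl4.
  assert (Hl5 : is_series (fun i => c (S i) * L - c (S i) * T (S i))%C (L * L - l)%C).
  { apply is_series_Cminus; [|exact Hl2].
    apply (is_series_Cext (fun i => L * c (S i))%C _ (L * L)%C);
      [intros i; ring | reflexivity | now apply is_series_Cscal]. }
  assert (El := is_series_unique_C _ _ _ Hl4 Hl5).
  apply (is_series_Cext (fun i => 2 * (g (S i) * I (S i)))%C _ (2 * l)%C).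
  - intros i. cbv zeta. unfold Csum_from1.
    rewrite (Csum_unique _ _ (Hinner (S i) ltac:(lia))).
    field. apply RtoC_neq_0, Rgt_not_eq, INR_S_pos.
  - replace (2 * l)%C with (l + l)%C by ring. rewrite El at 1. ring.
  - now apply is_series_Cscal.
Qed.
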